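(* Let $u\in L^p(X,\nu)$ for some $p>1$. Then $u\in BV(X,\nu)$ if and only if $V(u)<+\infty$. In this case the measure $m$ from the definition of $BV(X,\nu)$ satisfies $|m|(X)=V(u)$.
   Context: $X$ is a separable real Hilbert space with inner product $\langle\cdot,\cdot\rangle$ and norm $\|\cdot\|$, $\nu$ is a Borel probability measure on $X$, and $R\in\mathcal L(X)$. $C^1_b(X)$ is the space of bounded, continuously Fréchet differentiable $\varphi:X\to\mathbb R$ with bounded gradient. Standing assumption: for every $z\in X$ there exists $v_z\in\bigcap_{p>1}L^p(X,\nu)$ with $\int_X\langle R\nabla\varphi,z\rangle\,d\nu=\int_X v_z\varphi\,d\nu$ for all $\varphi\in C^1_b(X)$. (In particular $uv_z\in L^1(X,\nu)$ for all $z$ when $u\in L^p$, $p>1$.) $\widetilde C^1_b(X,X)$ is the set of vector fields $F=\sum_{i=1}^n f_iz_i$ with $n\in\mathbb N$, $f_i\in C^1_b(X)$, $z_i\in X$; for such $F$ set $M^*F:=\sum_{i=1}^n\big(-\langle R\nabla f_i,z_i\rangle+v_{z_i}f_i\big)$. For $u\in L^1(X,\nu)$ with $uv_z\in L^1(X,\nu)$ for all $z\in X$, $V(u):=\sup\{\int_X u\,M^*F\,d\nu:\ F\in\widetilde C^1_b(X,X),\ \|F(x)\|\le1\ \forall x\in X\}$. $\mathcal M(X,X)$ denotes the countably additive $X$-valued Borel measures $m$ on $X$ with finite total variation $|m|(X)=\sup\sum_n\|m(B_n)\|$ (supremum over countable Borel partitions of $X$). Such a $u$ belongs to $BV(X,\nu)$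 if there is $m\in\mathcal M(X,X)$ such that, with $m_z(B):=\langle m(B),z\rangle$, one has $\int_X u(\langle R\nabla\varphi,z\rangle-v_z\varphi)\,d\nu=-\int_X\varphi\,dm_z$ for all $z\in X$ and $\varphi\in C^1_b(X)$. *)

(* Defs.v *)
From HB Require Import structures.
From mathcomp Require Import all_boot all_order all_algebra.
From mathcomp Require Import all_classical all_reals all_analysis.

Set Implicit Arguments.
Unset Strict Implicit.
Unset Printing Implicit Defensive.

Import Order.TTheory GRing.Theory Num.Theory.
Import numFieldNormedType.Exports.

Local Open Scope classical_set_scope.
Local Open Scope ring_scope.

Section defs.
Variables (R : realType) (X : completeNormedModType R).

(** [ip] is an inner product on [X] inducing the norm of [X]
    (so [X], being complete, is a real Hilbert space). *)
Definition hs_is_inner_product (ip : X -> X -> R) : Prop :=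
  (forall x y, ip x y = ip y x) /\
  (forall (a : R) x y w, ip (a *: x + y) w = a * ip x w + ip y w) /\
  (forall x, ip x x = `|x| ^+ 2).

Definition hs_separable_space : Prop :=
  exists D : set X, countable D /\ closure D = setT.

Definition hs_XB := g_sigma_algebraType (@open X).

Variable ip : X -> X -> R.

Definition hs_C1b (phi : X -> R) (g : X -> X) : Prop :=
  (exists M : R, forall x, `|phi x| <= M) /\
  (forall x, differentiable phi x /\ forall h, 'd phi x h = ip (g x) h) /\
  continuous g /\
  (exists M : R, forall x, `|g x| <= M).

Variable nu : probability hs_XB R.

Definition hs_inLp (p : R) (f : X -> R) : Prop :=
  measurable_fun [set: hs_XB] (f : hs_XB -> R) /\
  (\int[nu]_x ((`|f x| `^ p)%:E) < +oo)%E.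

Variables (Rop : {linear X -> X}) (v : X -> X -> R).

Definition hs_standing_assumption : Prop :=
  forall z : X,
    (forall q : R, 1 < q -> hs_inLp q (v z)) /\
    (forall phi g, hs_C1b phi g ->
       (\int[nu]_x ((ip (Rop (g x)) z)%:E) = \int[nu]_x ((v z x * phi x)%:E))%E).

(** M^* F for F = \sum_i f i * z i, with g i the gradient of f i. *)
Definition hs_Mstar n (f : 'I_n -> X -> R) (g : 'I_n -> X -> X) (z : 'I_n -> X)
  (x : X) : R :=
  \sum_(i < n) (- ip (Rop (g i x)) (z i) + v (z i) x * f i x).

Definition hs_Vvar (u : X -> R) : \bar R :=
  ereal_sup [set r | exists n (f : 'I_n -> X -> R) (g : 'I_n -> X -> X)
                       (z : 'I_n -> X),
     (forall i, hs_C1b (f i) (g i)) /\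
     (forall x, `| \sum_(i < n) f i x *: z i | <= 1) /\
     r = (\int[nu]_x ((u x * hs_Mstar f g z x)%:E))%E].

Definition hs_vector_measure (m : set hs_XB -> X) : Prop :=
  m set0 = 0 /\
  forall B : nat -> set hs_XB, (forall n, measurable (B n)) -> trivIset setT B ->
    (fun N => \sum_(0 <= n < N) m (B n)) @ \oo --> m (\bigcup_n B n).

Definition hs_total_variation (m : set hs_XB -> X) : \bar R :=
  ereal_sup [set s | exists B : nat -> set hs_XB,
     (forall n, measurable (B n)) /\ trivIset setT B /\
     \bigcup_n B n = setT /\
     s = (\sum_(0 <= n <oo) ((`|m (B n)|)%:E))%E].

(** [hs_signed_integral mz phi I] : I = \int phi d(mz) for the finite signed
    measure mz, computed through a decomposition mz = mu1 - mu2 into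
    finite (positive) measures. *)
Definition hs_signed_integral (mz : set hs_XB -> R) (phi : X -> R) (I : \bar R)
  : Prop :=
  exists mu1 mu2 : {finite_measure set hs_XB -> \bar R},
    (forall B, measurable B -> (mz B)%:E = (mu1 B - mu2 B)%E) /\
    I = (\int[mu1]_x ((phi x)%:E) - \int[mu2]_x ((phi x)%:E))%E.

Definition hs_BV_measure (u : X -> R) (m : set hs_XB -> X) : Prop :=
  hs_vector_measure m /\ (hs_total_variation m < +oo)%E /\
  forall (z : X) (phi : X -> R) (g : X -> X), hs_C1b phi g ->
    exists I, hs_signed_integral (fun B => ip (m B) z) phi I /\
      (\int[nu]_x ((u x * (ip (Rop (g x)) z - v z x * phi x))%:E) = - I)%E.

Definition hs_inBV (u : X -> R) : Prop := exists m, hs_BV_measure u m.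

End defs.

Arguments hs_vector_measure {R X} m.
Arguments hs_total_variation {R X} m.

(* Main.v *)
Require Import Defs.
From HB Require Import structures.
From mathcomp Require Import all_boot all_order all_algebra.
From mathcomp Require Import all_classical all_reals all_analysis.
From mathcomp Require Import measurable_realfun.
From mathcomp Require Import ring lra.
Import Order.TTheory GRing.Theory Num.Theory.
Import numFieldNormedType.Exports.
Local Open Scope classical_set_scope.
Local Open Scope ring_scope.

Set Implicit Arguments.
Unset Strict Implicit.
Unset Printing Implicit Defensive.

(** The inequality [V(u) <= |m|(X)] follows by integrating step functions in the
    values of the [f_i]. For the converse inequality, the product
    [\prod_(k < n) (1 - f_k)] turns [C^1] functions [f_n] with values in [0, 1]
    into the sub-partition of unity [f_n \prod_(k < n) (1 - f_k)], so that
    [F = \sum_n f_n \prod_(k < n) (1 - f_k) z_n] is admissible for unit vectors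
    [z_n]; a monotone class argument, one index at a time, replaces [f_n] by the
    indicator functions of disjoint Borel sets.

    If [V(u)] is finite, then for each [z] the functional
    [phi |-> \int u M^*(phi z) dnu] is bounded for the sup norm. It is a
    difference of positive functionals, each given by a finite measure through
    Daniell's construction. Continuity along decreasing sequences holds on
    weakly continuous functions by Dini's theorem on balls, which are weakly
    compact, and by tightness: disjointly supported test functions cannot each
    carry a fixed amount of a finite total mass. General [phi] are reached
    through the finite-dimensional projections [phi \o P_n]. The resulting
    signed measures [m_z(B)] are linear and bounded in [z], and the Riesz
    theorem gives [m(B)]. *)

(** Two obstacles shape the construction. The space need not be locally compact, and C^1 functions
    are not stable under minima, so the lattice form of Daniell's theorem does not apply as such:
    squared positive parts, products and [1 - (1 - t)^n] stand in for truncations, and the quotient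
    [f / (f^2 + d^2)] for the splitting of a function that lies below a sum. Two classes of test
    functions are kept apart. Covers are made of weakly continuous functions ([wC1]), because Dini's
    theorem needs them. In infinite dimension, however, a weakly continuous function of bounded
    support vanishes, so no cutoff is available there; the positive part of a functional is
    therefore a supremum over all of [C1], where cutoffs may be multiplied in. A further difficulty
    is that the defining identity of [v z] fixes it only almost everywhere: linearity in [z] holds
    off a null set that depends on the vectors, and is used under the integral sign. *)

(** * Hilbert space geometry: Riesz representation, weak compactness, finite-rank projections *)

Section inner_product.
Variables (R : realType) (X : completeNormedModType R) (ip : X -> X -> R).
Hypothesis ipP : hs_is_inner_product ip.

Lemma ipC x y : ip x y = ip y x. Proof. by case: ipP. Qed.
Lemma ip_linl a x y w : ip (a *: x + y) w = a * ip x w + ip y w.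
Proof. by case: ipP => _ []. Qed.
Lemma ipxx x : ip x x = `|x| ^+ 2. Proof. by case: ipP => _ []. Qed.
Lemma ipDl x y w : ip (x + y) w = ip x w + ip y w.
Proof. by have := ip_linl 1 x y w; rewrite scale1r mul1r. Qed.
Lemma ip0l w : ip 0 w = 0.
Proof. by have := ipDl 0 0 w; rewrite addr0 => /eqP; rewrite -subr_eq0 opprD addrA subrr sub0r oppr_eq0 => /eqP. Qed.
Lemma ipZl a x w : ip (a *: x) w = a * ip x w.
Proof. by have := ip_linl a x 0 w; rewrite addr0 ip0l addr0. Qed.
Lemma ipNl x w : ip (- x) w = - ip x w.
Proof. by rewrite -scaleN1r ipZl mulN1r. Qed.
Lemma ipBl x y w : ip (x - y) w = ip x w - ip y w.
Proof. by rewrite ipDl ipNl. Qed.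
Lemma ipDr w x y : ip w (x + y) = ip w x + ip w y.
Proof. by rewrite ipC ipDl !(ipC w). Qed.
Lemma ipZr w a x : ip w (a *: x) = a * ip w x.
Proof. by rewrite ipC ipZl (ipC w). Qed.
Lemma ip0r w : ip w 0 = 0. Proof. by rewrite ipC ip0l. Qed.
Lemma ipNr w x : ip w (- x) = - ip w x.
Proof. by rewrite ipC ipNl (ipC w). Qed.
Lemma ipBr w x y : ip w (x - y) = ip w x - ip w y.
Proof. by rewrite ipDr ipNr. Qed.
Lemma ip_suml (I : Type) (r : seq I) (P : pred I) (F : I -> X) w :
  ip (\sum_(i <- r | P i) F i) w = \sum_(i <- r | P i) ip (F i) w.
Proof.
by elim/big_rec2: _ => [|i a b _ <-]; rewrite ?ip0l// ipDl.
Qed.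

Lemma ip_inj x y : (forall z, ip x z = ip y z) -> x = y.
Proof.
move=> h; apply/eqP; rewrite -subr_eq0 -normr_eq0 -sqrf_eq0 -ipxx ipBl.
by rewrite h subrr.
Qed.

Lemma normB_sqr x y : `|x - y| ^+ 2 = `|x| ^+ 2 - 2 * ip x y + `|y| ^+ 2.
Proof. by rewrite -!ipxx ipBl !ipBr (ipC y x); ring. Qed.

Lemma normD_sqr x y : `|x + y| ^+ 2 = `|x| ^+ 2 + 2 * ip x y + `|y| ^+ 2.
Proof. by rewrite -!ipxx ipDl !ipDr (ipC y x); ring. Qed.

Lemma ip_CS x y : `|ip x y| <= `|x| * `|y|.
Proof.
have [->|y0] := eqVneq y 0; first by rewrite ip0r !normr0 mulr0.
have ny : 0 < `|y| by rewrite normr_gt0.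
have ny2 : 0 < `|y| ^+ 2 by rewrite exprn_gt0.
have : 0 <= `|(`|y| ^+ 2) *: x - ip x y *: y| ^+ 2 by rewrite exprn_ge0.
rewrite -[X in 0 <= X]ipxx ipBl !ipBr !ipZl !ipZr !ipxx (ipC y x) => h.
have h2 : 0 <= `|y| ^+ 2 * (`|x| ^+ 2 * `|y| ^+ 2 - ip x y ^+ 2) by move: h; congr (_ <= _); ring.
rewrite -(ler_pXn2r (n:=2)) ?nnegrE ?mulr_ge0//.
rewrite real_normK ?num_real// exprMn -subr_ge0.
by rewrite pmulr_rge0 in h2.
Qed.

Lemma ip_continuousl z : continuous (fun x => ip x z).
Proof.
move=> x; apply/cvgrPdist_lt => e e0.
near=> y; rewrite -ipBl.
apply: (le_lt_trans (ip_CS _ _)).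
have z1 : 0 < `|z| + 1 by rewrite ltr_wpDl.
apply: (@le_lt_trans _ _ (`|x - y| * (`|z| + 1))).
  by rewrite ler_wpM2l// lerDl.
rewrite -ltr_pdivlMr//.
near: y; apply: (@cvgr_dist_lt _ _ _ (nbhs x) _ id x); first exact: cvg_id.
by rewrite divr_gt0.
Unshelve. all: by end_near. Qed.

Lemma ip_cvgl {T} (F : set_system T) {FF : Filter F} (f : T -> X) x z :
  f @ F --> x -> ip (f y) z @[y --> F] --> ip x z.
Proof. by move=> fx; have := @ip_continuousl z x; move=> h; exact: (cvg_comp f (ip ^~ z) fx h). Qed.

Lemma quad_min_lin (a b : R) : (forall t, 0 <= 2 * t * a + t ^+ 2 * b) -> a = 0.
Proof.
move=> h; apply/eqP; apply/negPn/negP => a0.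
have b0 : 0 <= b.
  have h1 := h 1; have := h (-1); nra.
have a2 : 0 < a ^+ 2 by rewrite lt_def sqr_ge0 sqrf_eq0 a0.
have hb : 0 < b + 1 by lra.
(* The minimiser would be [- a / b]; the denominator [b + 1] also covers [b = 0]. *)
have := h (- a / (b + 1)).
have -> : 2 * (- a / (b + 1)) * a + (- a / (b + 1)) ^+ 2 * b
  = - (a ^+ 2) * (b + 2) / (b + 1) ^+ 2 by field; lra.
rewrite leNgt => /negP; apply.
rewrite pmulr_llt0 ?invr_gt0 ?exprn_gt0//; nra.
Qed.

(* The representing vector minimises [|x|^2 - 2 l x]; a minimising sequence is
   Cauchy by the parallelogram law, and no continuity of [l] is needed. *)
Lemma riesz_representation (l : X -> R) (C : R) :
  (forall a x y, l (a *: x + y) = a * l x + l y) ->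
  (forall x, `|l x| <= C * (1 + `|x|)) ->
  exists w, forall x, l x = ip w x.
Proof.
move=> llin lbd.
pose J x := `|x| ^+ 2 - 2 * l x.
(* Completing the square: [|x|^2 - 2 C (1 + |x|) = (|x| - C)^2 - 2 C - C^2]. *)
have Jlb x : - (2 * C + C ^+ 2) <= J x.
  rewrite /J; have := lbd x; rewrite ler_norml => /andP[_ h].
  have := sqr_ge0 (`|x| - C); rewrite expr2; nra.
pose S := range J.
have S0 : S !=set0 by exists (J 0), 0.
have Slb : has_lbound S by exists (- (2 * C + C ^+ 2)) => _ [x _ <-].
have hS : has_inf S by split.
pose j := inf S.
have jJ x : j <= J x by apply: ge_inf => //; exists x.
have /choice[x xP] : forall n : nat, exists x, J x < j + n.+1%:R^-1.
  move=> n; have [|_ [x _ <-] hx] := @inf_adherent _ S n.+1%:R^-1 _ hS.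
    by rewrite invr_gt0.
  by exists x.
clearbody j.
have l0 : l 0 = 0 by have := llin (-1) 0 0; rewrite scaler0 addr0 => e; lra.
have lD y z : l (y + z) = l y + l z by have := llin 1 y z; rewrite scale1r mul1r.
have lZ a y : l (a *: y) = a * l y by have := llin a y 0; rewrite addr0 l0 addr0.
have par y z : `|y - z| ^+ 2 <= 2 * (J y - j) + 2 * (J z - j).
  have := jJ (2^-1 *: (y + z)); rewrite /J lZ lD normrZ exprMn normD_sqr normB_sqr.
  have -> : `|2^-1 : R| ^+ 2 = 4^-1 by rewrite ger0_norm ?invr_ge0//; field.
  lra.
have inv0 : (n.+1%:R^-1 : R) @[n --> \oo] --> (0 : R) by exact: cvg_harmonic.
have cx : cvgn x.
  apply/cauchy_cvgP/cauchy_exP => e e0.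
  have [N _ hN] : \forall n \near \oo, (n.+1%:R^-1 : R) < e ^+ 2 / 4.
    by apply: (cvgr_lt _ inv0); rewrite divr_gt0// exprn_gt0.
  exists (x N); exists N => // n /= Nn.
  rewrite -ball_normE /=.
  rewrite -(ltr_pXn2r (n:=2)) ?nnegrE ?normr_ge0 ?(ltW e0)//.
  apply: le_lt_trans (par _ _) _.
  have h1 : (N.+1%:R^-1 : R) < e ^+ 2 / 4 := hN N (leqnn N).
  have h2 : (n.+1%:R^-1 : R) < e ^+ 2 / 4 := hN n Nn.
  move: (xP N) (xP n) h1 h2; move: (J (x N)) (J (x n)) (N.+1%:R^-1 : R) (n.+1%:R^-1 : R).
  by move=> A B c d; lra.
(* The first-order condition is read off along the sequence: [J (x n + t h) >= j > J (x n) - 1 / (n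
   + 1)] becomes in the limit a quadratic inequality in [t]. *)
exists (limn x) => h; apply/eqP; rewrite eq_sym -subr_eq0; apply/eqP.
apply: (@quad_min_lin _ (`|h| ^+ 2)) => t.
have hc : n.+1%:R^-1 + (2 * t * (ip (x n) h - l h) + t ^+ 2 * `|h| ^+ 2) @[n --> \oo]
   --> 0 + (2 * t * (ip (limn x) h - l h) + t ^+ 2 * `|h| ^+ 2).
  apply: cvgD => //; apply: cvgD; last exact: cvg_cst.
  apply: cvgMr; apply: cvgB; last exact: cvg_cst.
  exact: ip_cvgl.
rewrite add0r in hc.
apply: (cvgr_to_ge hc).
near=> n.
have := jJ (x n + t *: h); have := xP n; rewrite /J normD_sqr lD lZ ipZr normrZ exprMn.
rewrite (real_normK (num_real t)).
move: (ip (x n) h) (l (x n)) (l h) (n.+1%:R^-1 : R) (`|x n|) (`|h|) => a b c d e f.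
by lra.
Unshelve. all: by end_near. Qed.

Definition weakly_cvg (F : set_system X) (w : X) :=
  forall z, ip y z @[y --> F] --> ip w z.

Lemma weakly_cvg_nbhs w : weakly_cvg (nbhs w) w.
Proof. by move=> z; exact: ip_continuousl. Qed.

(** Along an ultrafilter every bounded real function [ip y z] of [y] converges; the limits are
    linear in [z] and at most [r * |z|], so the Riesz theorem turns them into a vector. *)
Lemma ball_weakly_compact (F : set_system X) (r : R) : UltraFilter F ->
  F [set x | `|x| <= r] -> exists w, weakly_cvg F w.
Proof.
move=> UF Fr.
have r0 : 0 <= r.
  by have [x /= xr] := filter_ex Fr; apply: le_trans xr.
have /choice[l lP] : forall z, exists l : R, `|l| <= r * `|z| /\ ip y z @[y --> F] --> l.
  move=> z; have := @segment_compact R (- (r * `|z|)) (r * `|z|).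
  move=> /(_ (ip y z @[y --> F]) _) [].
    suff : F (ip^~ z @^-1` `[- (r * `|z|), r * `|z|]%classic) by [].
    apply: filterS Fr => y /= yr.
    rewrite /= in_itv /= -ler_norml; apply: le_trans (ip_CS _ _) _.
    by rewrite ler_wpM2r.
  move=> l []; rewrite /= in_itv /= -ler_norml => lr cl; exists l; split => //.
  move=> B lB; have [//|FC] := in_ultra_setVsetC (ip^~ z @^-1` B) UF.
  by have [y []] := cl (~` B) B FC lB.
have llin a x y : l (a *: x + y) = a * l x + l y.
  have h1 : ip v (a *: x + y) @[v --> F] --> l (a *: x + y) by case: (lP (a *: x + y)).
  have h2 : ip v (a *: x + y) @[v --> F] --> a * l x + l y.
    under eq_cvg do rewrite ipDr ipZr.
    apply: cvgD; last by case: (lP y).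
    by apply: cvgMr; case: (lP x).
  exact: (cvg_unique (@Rhausdorff R) h1 h2).
have lbd x : `|l x| <= r * (1 + `|x|).
  by have [h _] := lP x; rewrite mulrDr mulr1 (le_trans h)// lerDr.
have [w lw] := riesz_representation llin lbd.
by exists w => z; rewrite -lw; case: (lP z).
Qed.

Lemma dense_sequence : hs_separable_space X ->
  exists a : nat -> X, forall x e, 0 < e -> exists n, `|x - a n| < e.
Proof.
move=> [D [/countable_injP[f finj] Dd]].
(* Numbers that code no point of [D] receive the value 0, which does not affect density. *)
exists (fun n => xget 0 [set x | D x /\ f x = n]) => x e e0.
have [y [Dy xy]] : D `&` ball x e !=set0.
  have : closure D x by rewrite Dd.
  by apply; exact: nbhsx_ballx.
exists (f y); case: xgetP => [z _ [Dz fz]|/(_ y)].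
  rewrite (finj z y) ?inE//.
  by rewrite -ball_normE in xy.
by move=> /not_andP[|]; case.
Qed.

Section gram_schmidt.
Variable a : nat -> X.

(** Equals 0 at [w = 0], so that a vector of the sequence depending on the earlier ones adds nothing
    to the projection. *)
Definition normalize (w : X) := `|w|^-1 *: w.

(** The orthogonal projection onto the span of [a 0, ..., a (n - 1)]: Gram-Schmidt written as a
    recursion on the projections themselves. *)
Fixpoint gs_proj n (x : X) : X :=
  if n is m.+1 then
    let e := normalize (a m - gs_proj m (a m)) in gs_proj m x + ip x e *: e
  else 0.

Let e m := normalize (a m - gs_proj m (a m)).

Lemma gs_projS m x : gs_proj m.+1 x = gs_proj m x + ip x (e m) *: e m.
Proof. by []. Qed.

Lemma gs_proj_lin n t x y : gs_proj n (t *: x + y) = t *: gs_proj n x + gs_proj n y.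
Proof.
elim: n => [|n ih]; first by rewrite /= scaler0 addr0.
rewrite !gs_projS ih ip_linl scalerDr scalerDl (scalerA t (ip x (e n))).
by rewrite -!addrA; congr (_ + _); rewrite addrCA.
Qed.

Lemma gs_proj0 n : gs_proj n 0 = 0.
Proof. by elim: n => //= n ->; rewrite ip0l scale0r addr0. Qed.

Lemma gs_projZ n t x : gs_proj n (t *: x) = t *: gs_proj n x.
Proof. by rewrite -[t *: x]addr0 gs_proj_lin gs_proj0 addr0. Qed.

Lemma gs_projB n x y : gs_proj n (x - y) = gs_proj n x - gs_proj n y.
Proof. by rewrite addrC -scaleN1r gs_proj_lin scaleN1r addrC. Qed.

Lemma gs_proj_adj n x y : ip (gs_proj n x) y = ip x (gs_proj n y).
Proof.
elim: n => [|n ih]; first by rewrite /= ip0l ip0r.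
by rewrite !gs_projS ipDl ipDr ih (ipZl (ip x (e n))) (ipZr x (ip y (e n))) (ipC (e n) y) mulrC.
Qed.

Lemma normalize_id w : ip (normalize w) (normalize w) *: normalize w = normalize w.
Proof.
have [->|w0] := eqVneq w 0; first by rewrite /normalize scaler0 scaler0.
rewrite ipxx normrZ normfV normr_id mulVf ?normr_eq0// expr1n scale1r//.
Qed.

(** The new direction [e n] is a multiple of [a n - gs_proj n (a n)], which the induction hypothesis
    shows to be annihilated by [gs_proj n]. *)
Lemma gs_proj_idem n x : gs_proj n (gs_proj n x) = gs_proj n x.
Proof.
elim: n x => // n ih x.
have Pe : gs_proj n (e n) = 0.
  by rewrite /e /normalize gs_projZ gs_projB ih subrr scaler0.
rewrite [LHS]gs_projS.
have -> : gs_proj n (gs_proj n.+1 x) = gs_proj n x.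
  by rewrite gs_projS addrC gs_proj_lin Pe scaler0 add0r ih.
have -> : ip (gs_proj n.+1 x) (e n) *: e n = ip x (e n) *: e n.
  rewrite gs_projS ipDl gs_proj_adj Pe ip0r add0r (ipZl (ip x (e n))).
  by rewrite -scalerA normalize_id.
by rewrite gs_projS.
Qed.

(** Self-adjointness and idempotence give [|P x|^2 = ip x (P x)]; Cauchy-Schwarz concludes. *)
Lemma gs_proj_contract n x : `|gs_proj n x| <= `|x|.
Proof.
have [->|P0] := eqVneq (gs_proj n x) 0; first by rewrite normr0.
have h : `|gs_proj n x| ^+ 2 <= `|x| * `|gs_proj n x|.
  rewrite -ipxx gs_proj_adj gs_proj_idem.
  by apply: le_trans (ler_norm _) (ip_CS _ _).
by rewrite expr2 ler_pM2r ?normr_gt0// in h.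
Qed.

Lemma gs_proj_id n i : (i < n)%N -> gs_proj n (a i) = a i.
Proof.
elim: n => // n ih; rewrite ltnS leq_eqVlt => /orP[/eqP ->|/[dup] /ih hi _].
  rewrite gs_projS; set w := a n - gs_proj n (a n).
  suff -> : ip (a n) (e n) *: e n = w by rewrite /w addrC subrK.
  have [w0|w0] := eqVneq w 0.
    by rewrite /e -/w w0 /normalize scaler0 scaler0.
  have -> : ip (a n) (e n) = `|w|.
    rewrite /e -/w /normalize ipZr.
    have -> : ip (a n) w = ip w w.
      rewrite /w ipBl [X in _ = _ - X]gs_proj_adj gs_projB gs_proj_idem subrr.
      by rewrite ip0r subr0.
    by rewrite ipxx expr2 mulrA mulVf ?mul1r// normr_eq0.
  by rewrite /e -/w /normalize scalerA mulfV ?scale1r// normr_eq0.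
have -> : gs_proj n.+1 (a i) = a i + ip (gs_proj n (a i)) (e n) *: e n by rewrite gs_projS hi.
rewrite gs_proj_adj /e /normalize gs_projZ gs_projB gs_proj_idem subrr scaler0.
by rewrite ip0r scale0r addr0.
Qed.

(** Finite rank turns weak convergence into norm convergence; this is what makes [phi \o gs_proj n]
    weakly continuous for a merely norm continuous [phi]. *)
Lemma gs_proj_weakly_continuous n (F : set_system X) w : Filter F ->
  weakly_cvg F w -> gs_proj n y @[y --> F] --> gs_proj n w.
Proof.
move=> FF Fw; elim: n => [|n ih] /=; first exact: cvg_cst.
by apply: cvgD => //; apply: cvgZr_tmp; exact: Fw.
Qed.

Lemma gs_proj_continuous n : continuous (gs_proj n).
Proof. by move=> x; apply: gs_proj_weakly_continuous; exact: weakly_cvg_nbhs. Qed.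

Hypothesis a_dense : forall x e, 0 < e -> exists n, `|x - a n| < e.

(** [gs_proj n] fixes [a i] for [i < n], so [x - P x = (x - a i) - P (x - a i)], of norm at most
    [2 |x - a i|]. *)
Lemma gs_proj_cvg x : gs_proj n x @[n --> \oo] --> x.
Proof.
apply/cvgrPdist_lt => eps eps0.
have [i hi] := a_dense x (divr_gt0 eps0 (ltr0Sn R 1)).
exists i.+1 => // n /= hn.
have -> : x - gs_proj n x = (x - a i) - gs_proj n (x - a i).
  by rewrite gs_projB (gs_proj_id hn) opprB addrA subrK.
have := ler_normB (x - a i) (gs_proj n (x - a i)).
have := gs_proj_contract n (x - a i); lra.
Qed.
End gram_schmidt.
End inner_product.

(** A global quadratic bound on the remainder identifies the differential; squared positive parts,
    inner products and the squared norm all admit one. *)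
Lemma is_diff_quadratic (R : realType) (V : normedModType R) (f : V -> R)
    (df : V -> R) (C : R) (x : V) :
  linear (df : V -> R^o) -> continuous df ->
  (forall h, `|f (h + x) - f x - df h| <= C * `|h| ^+ 2) -> is_diff x f df.
Proof.
move=> dflin dfc hC.
pose dfM := GRing.isLinear.Build R V R^o _ df dflin.
pose dfL : {linear V -> R^o} := HB.pack df dfM.
have exp : f \o shift x = cst (f x) + df +o_ 0 id.
  apply/eqaddoP => e e0.
  near=> h.
  have := hC h; rewrite !fctE /= opprD addrA => /le_trans; apply.
  rewrite expr2 mulrA ler_wpM2r//.
  apply: (@le_trans _ _ ((`|C| + 1) * `|h|)).
    by rewrite ler_wpM2r// (le_trans (ler_norm _))// lerDl.
  rewrite mulrC -ler_pdivlMr ?ltr_wpDl//.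
  near: h; apply: nbhs0_le; rewrite divr_gt0 ?ltr_wpDl//.
have E : 'd f x = df :> (V -> R) by apply: (@diff_unique _ _ _ _ dfL).
apply: DiffDef => //.
by apply/diff_locallyP; rewrite E.
Unshelve. all: by end_near. Qed.

(** * A C^1 step function on the line *)

Section plateau.
Context {R : realType}.
Implicit Types t : R.

(** The squared positive part is C^1 and vanishes exactly on [t <= 0]; composing it with itself
    yields a step function without exponentials. *)
Definition sqpos t : R := (Num.max 0 t) ^+ 2.

Lemma is_diff_sqpos t : is_diff t (sqpos : R -> R) (fun h => 2 * Num.max 0 t * h).
Proof.
apply: (@is_diff_quadratic _ _ _ _ 1).
- by move=> a x y /=; rewrite /GRing.scale /=; ring.
- by move=> x; apply: cvgMr.
- move=> h; rewrite /sqpos mul1r real_normK ?num_real//.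
  rewrite ler_norml.
  by have [h1|h1] := leP 0 (h + t); have [h2|h2] := leP 0 t; apply/andP; split; nra.
Qed.

Lemma max0_continuous : continuous (fun t : R => Num.max 0 t).
Proof. by move=> t; apply: (@continuous_max _ _ (cst 0) id) => //; exact: cst_continuous. Qed.

Lemma sqpos_continuous : continuous (sqpos : R -> R).
Proof. by move=> t; apply: differentiable_continuous; apply: (@ex_diff _ _ _ _ _ _ _ (is_diff_sqpos t)). Qed.

(* A C^1 transition from [0] (on [t <= 0]) to [1] (on [t >= 1]). *)
Definition plateau t : R := 1 - sqpos (1 - sqpos t).
Definition dplateau t : R := 4 * Num.max 0 (1 - sqpos t) * Num.max 0 t.

Lemma is_diff_plateau t : is_diff t (plateau : R -> R) (fun h => dplateau t * h).
Proof.
have d1 := is_diffB (is_diff_cst (1 : R) t) (is_diff_sqpos t).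
have d2 := is_diff_comp d1 (is_diff_sqpos (1 - sqpos t)).
apply: (is_diff_eq (is_diffB (is_diff_cst (1 : R) t) d2)).
apply/funext => h.
transitivity (0 - (2 * Num.max 0 (1 - sqpos t) * (0 - 2 * Num.max 0 t * h))) => //.
by rewrite /dplateau; ring.
Qed.

Lemma plateau_continuous : continuous (plateau : R -> R).
Proof. by move=> t; apply: differentiable_continuous; apply: (@ex_diff _ _ _ _ _ _ _ (is_diff_plateau t)). Qed.

Lemma dplateau_continuous : continuous (dplateau : R -> R).
Proof.
move=> t; apply: cvgM; last exact: max0_continuous.
apply: cvgMr; apply: (@continuous_comp _ _ _ (fun t => 1 - sqpos t)); last exact: max0_continuous.
by apply: cvgB; [exact: cvg_cst|exact: sqpos_continuous].
Qed.

Lemma sqpos_le1 t : t <= 1 -> sqpos t <= 1.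
Proof. by move=> t1; rewrite /sqpos expr_le1// ?le_max ?lexx// ge_max ler01. Qed.

Lemma plateau_ge0 t : 0 <= plateau t.
Proof. by rewrite subr_ge0 sqpos_le1// lerBlDr lerDl sqr_ge0. Qed.

Lemma plateau_le1 t : plateau t <= 1.
Proof. by rewrite /plateau lerBlDr lerDl sqr_ge0. Qed.

Lemma plateau_le0 t : t <= 0 -> plateau t = 0.
Proof.
by move=> t0; rewrite /plateau /sqpos (max_l t0) expr0n /= subr0 max_r// expr1n subrr.
Qed.

Lemma plateau_ge1 t : 1 <= t -> plateau t = 1.
Proof.
move=> t1; rewrite /plateau /sqpos (@max_r _ _ 0 t) ?(le_trans ler01)//.
by rewrite max_l ?expr0n ?subr0// subr_le0; nra.
Qed.

Lemma plateau_gt0 t : 0 < t -> 0 < plateau t.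
Proof.
move=> t0; have s0 : 0 < sqpos t by rewrite exprn_gt0// lt_max t0 orbT.
rewrite subr_gt0 /(sqpos (1 - _)) expr_lt1 ?le_max ?lexx//.
by rewrite gt_max ltr01 /= ltrBlDr ltrDl.
Qed.

Lemma dplateau_le0 t : t <= 0 -> dplateau t = 0.
Proof. by move=> t0; rewrite /dplateau (max_l t0) mulr0. Qed.

Lemma dplateau_ge1 t : 1 <= t -> dplateau t = 0.
Proof.
move=> t1; rewrite /dplateau /sqpos (@max_r _ _ 0 t) ?(le_trans ler01)//.
by rewrite max_l ?mulr0 ?mul0r// subr_le0; nra.
Qed.

Lemma dplateau_bound t : `|dplateau t| <= 4.
Proof.
have [t0|t0] := leP t 0; first by rewrite dplateau_le0// normr0.
have [t1|t1] := leP 1 t; first by rewrite dplateau_ge1// normr0.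
rewrite /dplateau /sqpos (@max_r _ _ 0 t) ?(ltW t0)//.
rewrite max_r; last by nra.
by rewrite ler_norml; apply/andP; split; nra.
Qed.
End plateau.

(** * Bounded C^1 functions, cutoffs, and the weakly continuous subclass *)

Section C1.
Variables (R : realType) (X : completeNormedModType R) (ip : X -> X -> R).
Hypothesis ipP : hs_is_inner_product ip.

Lemma C1bP (f : X -> R) (g : X -> X) :
  hs_C1b ip f g <-> [/\ exists M, forall x, `|f x| <= M,
    forall x, is_diff x f (ip (g x)), continuous g & exists M, forall x, `|g x| <= M].
Proof.
split=> [[? [h [? ?]]]|[? h ? ?]]; split => //.
  move=> x; have [d e] := h x; apply: DiffDef => //; exact/funext.
split => // x; have hx := h x; split; first exact: (@ex_diff _ _ _ _ _ _ _ hx).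
by move=> y; rewrite (@diff_val _ _ _ _ _ _ _ hx).
Qed.

Lemma C1b_grad_unique f g g' : hs_C1b ip f g -> hs_C1b ip f g' -> g = g'.
Proof.
move=> [_ [h _]] [_ [h' _]]; apply/funext => x; apply: (ip_inj ipP) => z.
by have [_ <-] := h x; have [_ <-] := h' x.
Qed.

Lemma C1b_cst c : hs_C1b ip (fun=> c) (fun=> 0).
Proof.
apply/C1bP; split.
- by exists `|c|.
- move=> x; apply: (is_diff_eq (is_diff_cst c x)).
  by apply/funext => h; rewrite (ip0l ipP).
- by move=> x; exact: cvg_cst.
- by exists 0 => x; rewrite normr0.
Qed.

Lemma C1b_continuous f g : hs_C1b ip f g -> continuous f.
Proof. by move=> [_ [h _]] x; apply: differentiable_continuous; case: (h x). Qed.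

Lemma C1b_add f1 g1 f2 g2 : hs_C1b ip f1 g1 -> hs_C1b ip f2 g2 ->
  hs_C1b ip (fun x => f1 x + f2 x) (fun x => g1 x + g2 x).
Proof.
move=> /C1bP[[M1 b1] d1 c1 [N1 e1]] /C1bP[[M2 b2] d2 c2 [N2 e2]]; apply/C1bP; split.
- by exists (M1 + M2) => x; rewrite (le_trans (ler_normD _ _))// lerD.
- move=> x; apply: (is_diff_eq (is_diffD (d1 x) (d2 x))).
  by apply/funext => h; rewrite (ipDl ipP).
- by move=> x; apply: cvgD; [exact: c1|exact: c2].
- by exists (N1 + N2) => x; rewrite (le_trans (ler_normD _ _))// lerD.
Qed.

Lemma C1b_mul f1 g1 f2 g2 : hs_C1b ip f1 g1 -> hs_C1b ip f2 g2 ->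
  hs_C1b ip (fun x => f1 x * f2 x) (fun x => f1 x *: g2 x + f2 x *: g1 x).
Proof.
move=> h1 h2; have k1 := C1b_continuous h1; have k2 := C1b_continuous h2.
move: h1 h2 => /C1bP[[M1 b1] d1 c1 [N1 e1]] /C1bP[[M2 b2] d2 c2 [N2 e2]]; apply/C1bP; split.
- by exists (M1 * M2) => x; rewrite normrM ler_pM.
- move=> x; apply: (is_diff_eq (is_diffM (d1 x) (d2 x))).
  by apply/funext => h; rewrite (ipDl ipP) !(ipZl ipP).
- move=> x; apply: cvgD; apply: cvgZ; [exact: k1|exact: c2|exact: k2|exact: c1].
- exists (M1 * N2 + M2 * N1) => x; rewrite (le_trans (ler_normD _ _))// !normrZ.
  by rewrite lerD// ler_pM.
Qed.

Lemma C1b_inv f g c : 0 < c -> (forall x, c <= f x) -> hs_C1b ip f g ->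
  hs_C1b ip (fun x => (f x)^-1) (fun x => (- (f x) ^- 2) *: g x).
Proof.
move=> c0 cf h1; have k1 := C1b_continuous h1.
have f0 x : 0 < f x := lt_le_trans c0 (cf x).
have fn0 x : f x != 0 by rewrite gt_eqF.
move: h1 => /C1bP[[M1 b1] d1 c1 [N1 e1]]; apply/C1bP; split.
- by exists c^-1 => x; rewrite gtr0_norm ?invr_gt0// lef_pV2 ?posrE.
- move=> x; have dx : differentiable f x by apply: (@ex_diff _ _ _ _ _ _ _ (d1 x)).
  apply: DiffDef; first exact: differentiableV.
  rewrite (diffV dx (fn0 x)) (@diff_val _ _ _ _ _ _ _ (d1 x)); apply/funext => h.
  by rewrite (ipZl ipP).
- move=> x; apply: cvgZ; last exact: c1.
  apply: cvgN; apply: cvgV; first by rewrite expf_neq0.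
  by under eq_cvg do rewrite expr2; rewrite expr2; apply: cvgM; exact: k1.
- exists (c ^- 2 * N1) => x; rewrite normrZ ler_pM// normrN gtr0_norm ?invr_gt0 ?exprn_gt0//.
  by rewrite lef_pV2 ?posrE ?exprn_gt0// ler_pXn2r// nnegrE ltW.
Qed.

(** Only the product [dplateau (f x) *: g x] has to be bounded, so [f] may be unbounded, as are
    [ip x z - c] and the squared norm. *)
Lemma C1b_plateau (f : X -> R) (g : X -> X) (M : R) :
  (forall x, is_diff x f (ip (g x))) -> continuous g ->
  (forall x, `|dplateau (f x) *: g x| <= M) ->
  hs_C1b ip (fun x => plateau (f x)) (fun x => dplateau (f x) *: g x).
Proof.
move=> df cg bg; apply/C1bP; split.
- by exists 1 => x; rewrite ger0_norm ?plateau_ge0 ?plateau_le1.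
- move=> x; apply: (is_diff_eq (is_diff_comp (df x) (is_diff_plateau (f x)))).
  by apply/funext => h /=; rewrite (ipZl ipP).
- move=> x; apply: cvgZ; last exact: cg.
  have fc : {for x, continuous f} by apply: differentiable_continuous; apply: (@ex_diff _ _ _ _ _ _ _ (df x)).
  by apply: (continuous_comp fc); exact: dplateau_continuous.
- by exists M.
Qed.

Lemma is_diff_ip x z : is_diff x (fun y => ip y z) (fun y => ip y z).
Proof.
apply: (@is_diff_quadratic _ _ _ _ 0).
- by move=> a u v; rewrite (ip_linl ipP).
- exact: (ip_continuousl ipP).
- by move=> h; rewrite (ipDl ipP) addrK subrr normr0 mul0r.
Qed.

Lemma is_diff_normsqr x : is_diff x (fun y : X => `|y| ^+ 2) (ip (2 *: x)).
Proof.
apply: (@is_diff_quadratic _ _ _ _ 1).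
- by move=> a u v; rewrite (ipDr ipP) (ipZr ipP).
- rewrite (_ : ip (2 *: x) = ip ^~ (2 *: x)); first exact: (ip_continuousl ipP).
  by apply/funext => y; exact: (ipC ipP).
- move=> h; rewrite (normD_sqr ipP) (ipZl ipP) (ipC ipP x h) mul1r.
  by rewrite (_ : _ - _ = `|h| ^+ 2) ?ger0_norm ?exprn_ge0//; ring.
Qed.

(** Weakly continuous and positive exactly on the open half-space [c < ip x z]; such half-spaces
    generate the Borel sets. *)
Definition halfspace_fun z c (x : X) : R := plateau (ip x z - c).

Lemma C1b_halfspace z c : exists g, hs_C1b ip (halfspace_fun z c) g.
Proof.
exists (fun x => dplateau (ip x z - c) *: z); apply: (@C1b_plateau _ _ (4 * `|z|)).
- move=> x; apply: (is_diff_eq (is_diffB (is_diff_ip x z) (is_diff_cst c x))); apply/funext => h; rewrite !fctE /= subr0.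
  exact: (ipC ipP).
- by move=> x; exact: cvg_cst.
- by move=> x; rewrite normrZ ler_wpM2r// dplateau_bound.
Qed.

(* Equal to [1] on the ball of square radius [n+1], to [0] off the ball of
   square radius [2(n+1)]; the gradients are bounded uniformly in [n]. *)
Definition cutoff n (x : X) : R := 1 - plateau (`|x| ^+ 2 / n.+1%:R - 1).
Definition dcutoff n (x : X) : X :=
  (- dplateau (`|x| ^+ 2 / n.+1%:R - 1)) *: ((2 / n.+1%:R) *: x).

(** 24 is 4 times 6: [dplateau] is at most 4, and where it does not vanish [|x|^2 <= 2 (n + 1)],
    hence [|x| <= 3 (n + 1)] and the inner gradient [2 |x| / (n + 1)] is at most 6. *)
Lemma dcutoff_bound n x : `|dcutoff n x| <= 24.
Proof.
rewrite /dcutoff; set t := _ - 1.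
have n1 : 1 <= n.+1%:R :> R by rewrite ler1n.
have n0 : 0 < n.+1%:R :> R by exact: lt_le_trans n1.
have [t1|t1] := leP 1 t; first by rewrite dplateau_ge1// oppr0 scale0r normr0.
have xn : `|x| <= 3 * n.+1%:R.
  have : `|x| ^+ 2 <= 2 * n.+1%:R.
    by rewrite -ler_pdivrMr//; move: t1; rewrite ltrBlDr => /ltW.
  have := normr_ge0 x; nra.
rewrite !normrZ normrN (_ : 24 = 4 * 6) ?ler_pM ?dplateau_bound ?mulr_ge0//; last by ring.
rewrite ger0_norm// normfV (gtr0_norm n0) mulrAC ler_pdivrMr//; lra.
Qed.

Lemma C1b_cutoff n : hs_C1b ip (cutoff n) (dcutoff n).
Proof.
have h : hs_C1b ip (fun x => plateau (`|x| ^+ 2 / n.+1%:R - 1))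
  (fun x => dplateau (`|x| ^+ 2 / n.+1%:R - 1) *: ((2 / n.+1%:R) *: x)).
  apply: (@C1b_plateau _ _ 24).
  - move=> x; have d1 := is_diffZ (n.+1%:R^-1) (is_diff_normsqr x).
    have d2 := is_diffB d1 (is_diff_cst (1 : R) x).
    have E : (n.+1%:R^-1 \*: (fun y : X => `|y| ^+ 2) - cst 1 : X -> R) = (fun y : X => `|y| ^+ 2 / n.+1%:R - 1).
      by apply/funext => y; rewrite !fctE /= mulrC.
    rewrite E in d2; apply: (is_diff_eq d2); apply/funext => h; rewrite !fctE /= subr0.
    by rewrite !(ipZl ipP) /GRing.scale /=; ring.
  - move=> x; exact: scaler_continuous.
  - by move=> x; have := dcutoff_bound n x; rewrite /dcutoff scaleNr normrN.
have := C1b_add (C1b_cst 1) (C1b_mul (C1b_cst (-1)) h).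
congr hs_C1b; apply/funext => x; rewrite /cutoff /dcutoff.
  by rewrite mulN1r.
by rewrite scaler0 addr0 add0r scaleN1r scaleNr.
Qed.

Lemma cutoff_ge0 n x : 0 <= cutoff n x.
Proof. by rewrite subr_ge0 plateau_le1. Qed.
Lemma cutoff_le1 n x : cutoff n x <= 1.
Proof. by rewrite lerBlDr lerDl plateau_ge0. Qed.

Lemma cutoff_in n x : `|x| ^+ 2 <= n.+1%:R -> cutoff n x = 1 /\ dcutoff n x = 0.
Proof.
move=> h; have h1 : `|x| ^+ 2 / n.+1%:R - 1 <= 0.
  by rewrite subr_le0 ler_pdivrMr ?mul1r.
by rewrite /cutoff /dcutoff plateau_le0// dplateau_le0// subr0 oppr0 scale0r.
Qed.

Lemma cutoff_out n x : 2 * n.+1%:R <= `|x| ^+ 2 -> cutoff n x = 0.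
Proof.
move=> h; rewrite /cutoff plateau_ge1 ?subrr//.
by rewrite lerBrDr ler_pdivlMr// (le_trans _ h)//; lra.
Qed.

Lemma C1b_gs_proj a f g n : hs_C1b ip f g ->
  hs_C1b ip (f \o gs_proj ip a n) (fun x => gs_proj ip a n (g (gs_proj ip a n x))).
Proof.
move=> h; have k := C1b_continuous h.
move: h => /C1bP[[M b] d c [N e]]; apply/C1bP; split.
- by exists M => x; exact: b.
- move=> x.
  have Plin : linear (gs_proj ip a n) by move=> t u v; exact: gs_proj_lin.
  pose PM := GRing.isLinear.Build R X X _ _ Plin.
  pose PL : {linear X -> X} := HB.pack (gs_proj ip a n) PM.
  have Pc : continuous PL by exact: gs_proj_continuous.
  have dP : is_diff x (PL : X -> X) PL.
    by apply: DiffDef; [exact: linear_differentiable|exact: diff_lin].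
  by apply: (is_diff_eq (is_diff_comp dP (d (PL x)))); apply/funext => y /=; rewrite gs_proj_adj.
- move=> x; have Pc := @gs_proj_continuous _ _ _ ipP a n.
  apply: (@continuous_comp _ _ _ (g \o gs_proj ip a n)); last exact: Pc.
  by apply: continuous_comp; [exact: Pc|exact: c].
- by exists N => x; apply: le_trans (e (gs_proj ip a n x)); exact: gs_proj_contract.
Qed.

Definition C1 (f : X -> R) := exists g, hs_C1b ip f g.

Lemma C1_cst c : C1 (fun=> c). Proof. by exists (fun=> 0); exact: C1b_cst. Qed.

Lemma C1_add f1 f2 : C1 f1 -> C1 f2 -> C1 (fun x => f1 x + f2 x).
Proof. by move=> [g1 h1] [g2 h2]; eexists; exact: C1b_add h1 h2. Qed.

Lemma C1_mul f1 f2 : C1 f1 -> C1 f2 -> C1 (fun x => f1 x * f2 x).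
Proof. by move=> [g1 h1] [g2 h2]; eexists; exact: C1b_mul h1 h2. Qed.

Lemma C1_bounded f : C1 f -> exists2 M, 0 < M & forall x, `|f x| <= M.
Proof.
move=> [g [[M hM] _]]; exists (`|M| + 1); first by rewrite ltr_wpDl.
by move=> x; rewrite (le_trans (hM x))// (le_trans (ler_norm _))// lerDl.
Qed.

Lemma C1_continuous f : C1 f -> continuous f.
Proof. by move=> [g h]; exact: C1b_continuous h. Qed.

(** Arbitrary filters are allowed, not only sequences: weak compactness of balls is used through
    ultrafilters. *)
Definition weakly_continuous (f : X -> R) := forall (F : set_system X) w,
  Filter F -> weakly_cvg ip F w -> f y @[y --> F] --> f w.

Definition wC1 (f : X -> R) := C1 f /\ weakly_continuous f.

Lemma wC1_C1 f : wC1 f -> C1 f. Proof. by case. Qed.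

Lemma wC1_cst c : wC1 (fun=> c).
Proof. by split; [exact: C1_cst|move=> F w FF _; exact: cvg_cst]. Qed.

Lemma wC1_add f1 f2 : wC1 f1 -> wC1 f2 -> wC1 (fun x => f1 x + f2 x).
Proof.
move=> [a1 b1] [a2 b2]; split; first exact: C1_add.
by move=> F w FF Fw; apply: cvgD; [exact: b1|exact: b2].
Qed.

Lemma wC1_mul f1 f2 : wC1 f1 -> wC1 f2 -> wC1 (fun x => f1 x * f2 x).
Proof.
move=> [a1 b1] [a2 b2]; split; first exact: C1_mul.
by move=> F w FF Fw; apply: cvgM; [exact: b1|exact: b2].
Qed.

Lemma wC1_sub f1 f2 : wC1 f1 -> wC1 f2 -> wC1 (fun x => f1 x - f2 x).
Proof.
move=> h1 h2; have := wC1_add h1 (wC1_mul (wC1_cst (-1)) h2).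
by congr wC1; apply/funext => x; rewrite mulN1r.
Qed.

Lemma C1_sub f1 f2 : C1 f1 -> C1 f2 -> C1 (fun x => f1 x - f2 x).
Proof.
move=> h1 h2; have := C1_add h1 (C1_mul (C1_cst (-1)) h2).
by congr C1; apply/funext => x; rewrite mulN1r.
Qed.

Lemma wC1_exp f k : wC1 f -> wC1 (fun x => f x ^+ k).
Proof.
move=> h; elim: k => [|k ih].
  by under eq_fun do rewrite expr0; exact: wC1_cst.
by under eq_fun do rewrite exprS; exact: wC1_mul.
Qed.

Lemma wC1_sum n (f : nat -> X -> R) : (forall i, wC1 (f i)) ->
  wC1 (fun x => \sum_(i < n) f i x).
Proof.
move=> h; elim: n => [|n ih].
  by under eq_fun do rewrite big_ord0; exact: wC1_cst.
by under eq_fun do rewrite big_ord_recr /=; exact: wC1_add.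
Qed.

Lemma wC1_halfspace z c : wC1 (halfspace_fun z c).
Proof.
split; first exact: C1b_halfspace.
move=> F w FF Fw; apply: (continuous_cvg _ (@plateau_continuous R _)).
by apply: cvgB; [exact: Fw|exact: cvg_cst].
Qed.

Lemma C1_cutoff n : C1 (cutoff n). Proof. by eexists; exact: C1b_cutoff. Qed.

Lemma wC1_gs_proj a f n : C1 f -> wC1 (f \o gs_proj ip a n).
Proof.
move=> [g h]; split; first by eexists; exact: C1b_gs_proj h.
move=> F w FF Fw; have cf : {for gs_proj ip a n w, continuous f} by exact: (C1b_continuous h).
apply: (continuous_cvg _ cf).
exact: gs_proj_weakly_continuous.
Qed.

Lemma continuous_measurable (f : X -> R) : continuous f ->
  measurable_fun [set: hs_XB X] (f : hs_XB X -> R).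
Proof.
move=> cf; apply: (measurability _ (RGenOInfty.measurableE R)).
move=> _ [_ [a ->] <-]; rewrite setTI.
have oa : open `]a, +oo[%classic by exact: rray_open.
by apply: sub_sigma_algebra; apply: open_comp => // x _; exact: cf.
Qed.

Lemma C1_measurable f : C1 f -> measurable_fun [set: hs_XB X] (f : hs_XB X -> R).
Proof. by move=> /C1_continuous; exact: continuous_measurable. Qed.

Lemma bounded_integrable (mu : {finite_measure set (hs_XB X) -> \bar R})
    (f : X -> R) (M : R) : measurable_fun [set: hs_XB X] (f : hs_XB X -> R) ->
  (forall x, `|f x| <= M) -> mu.-integrable [set: hs_XB X] (EFin \o f).
Proof.
move=> mf bf; apply: measurable_bounded_integrable => //.
  exact: fin_num_fun_lty.
exists M; split; first exact: num_real.
by move=> y My x _; apply: (le_trans (bf x)); exact: ltW.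
Qed.
End C1.

(** * Half-spaces generate the Borel sets; a monotone class theorem *)

Section monotone_class.
Variables (R : realType) (X : completeNormedModType R) (ip : X -> X -> R).
Hypothesis ipP : hs_is_inner_product ip.
Hypothesis sep : hs_separable_space X.

Notation wC1 := (wC1 ip).

(** Writes a closed ball as a countable intersection of half-spaces. Testing with [d m] close to [y]
    instead of [y] costs at most [(r + |y|) |y - d m|]. *)
Lemma norm_le_dense (d : nat -> X) (y : X) (r : R) :
  (forall x e, 0 < e -> exists n, `|x - d n| < e) -> 0 <= r ->
  (forall m, ip y (d m) <= r * `|d m|) -> `|y| <= r.
Proof.
move=> dd r0 h.
have [->|y0] := eqVneq y 0; first by rewrite normr0.
rewrite -(@ler_pM2r _ `|y|) ?normr_gt0// -expr2 -(ipxx ipP).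
apply/ler_addgt0Pr => e e0.
have k0 : 0 < r + `|y| + 1 by rewrite ltr_wpDl// addr_ge0.
have [m hm] := dd y _ (divr_gt0 e0 k0).
have -> : ip y y = ip y (d m) + ip y (y - d m).
  by rewrite -(ipDr ipP) addrC subrK.
have h1 := h m.
have h2 : ip y (y - d m) <= `|y| * `|y - d m|.
  by apply: le_trans (ler_norm _) (ip_CS ipP _ _).
have h3 := ler_normB y (y - d m); have e3 : y - (y - d m) = d m by rewrite opprB addrC subrK.
rewrite e3 in h3.
have h4 : (r + `|y|) * `|y - d m| <= e.
  apply: (@le_trans _ _ ((r + `|y| + 1) * (e / (r + `|y| + 1)))).
    by rewrite ler_pM ?addr_ge0 ?(ltW hm)// lerDl.
  by rewrite mulrC divfK ?gt_eqF.
have h5 := ler_wpM2l r0 h3.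
lra.
Qed.

(** By separability closed balls are complements of countable unions of open half-spaces, and open
    sets are countable unions of closed balls with centres in a dense sequence and radii
    [1 / (k + 1)]. *)
Lemma borel_induction (S : set (set X)) :
  S set0 -> (forall A, S A -> S (~` A)) ->
  (forall F : nat -> set X, (forall n, S (F n)) -> S (\bigcup_n F n)) ->
  (forall z c, S [set x | c < ip x z]) ->
  forall B : set (hs_XB X), measurable B -> S B.
Proof.
move=> S0 SC SU SH.
have [d dd] := dense_sequence sep.
have Sball a r : 0 <= r -> S [set x | `|x - a| <= r].
  move=> r0.
  have -> : [set x | `|x - a| <= r] =
      ~` \bigcup_m [set x | r * `|d m| + ip a (d m) < ip x (d m)].
    apply/seteqP; split => x /=.
      move=> xr [m _ /=]; apply/negP; rewrite -leNgt -lerBlDr -(ipBl ipP).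
      apply: le_trans (le_trans (ler_norm _) (ip_CS ipP _ _)) _.
      by rewrite ler_wpM2r.
    move=> h; apply: (norm_le_dense dd) => // m.
    rewrite (ipBl ipP) lerBlDr leNgt; apply/negP => hm.
    by apply: h; exists m.
  by apply: SC; apply: SU => m; exact: SH.
apply: smallest_sub.
  split => //; first by move=> A SA; rewrite setTD; exact: SC.
move=> A oA.
pose Bk n k := [set x | `|x - d n| <= k.+1%:R^-1].
(* Balls that leave [A] are replaced by the empty set, so that the union runs over all pairs [n],
   [k]. *)
pose F n k := if `[< Bk n k `<=` A >] then Bk n k else set0.
have -> : A = \bigcup_n \bigcup_k F n k.
  apply/seteqP; split => x.
    move=> Ax.
    have /nbhs_ballP[e /= e0 he] : nbhs x A by exact: open_nbhs_nbhs.
    have [k hk] : exists k, (k.+1%:R^-1 : R) < e / 2.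
      have := @cvg_harmonic R; move=> /cvgr_lt /(_ (e / 2)).
      by move=> /(_ (divr_gt0 e0 (ltr0Sn R 1))) [N _ hN]; exists N; exact: (hN N (leqnn N)).
    have [n hn] := dd x k.+1%:R^-1 (eqbRL (invr_gt0 _) (ltr0Sn R k)).
    exists n => //; exists k => //; rewrite /F; case: asboolP => [_|]; first by exact: ltW.
    case=> y /= hy; apply: he; rewrite -ball_normE /=.
    rewrite -(subrK (d n) x) -addrA (le_lt_trans (ler_normD _ _))//.
    rewrite (distrC (d n)); have hy' : `|y - d n| <= k.+1%:R^-1 := hy; apply: (lt_le_trans (ltr_leD hn hy')).
    by move: hk; move: (k.+1%:R^-1 : R) => q; lra.
  by move=> [n _ [k _]]; rewrite /F; case: asboolP => // h /h.
apply: (SU) => n; apply: (SU) => k; rewrite /F; case: asboolP => // _.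
by apply: Sball; rewrite invr_ge0.
Qed.

(** Sequences need not be monotone: values in [0, 1] suffice for the dominated convergence theorem,
    through which every instance is obtained. *)
Definition limit_closed (Q : (X -> R) -> Prop) :=
  forall (F : nat -> X -> R) (f : X -> R), (forall n, Q (F n)) ->
    (forall n x, 0 <= F n x <= 1) -> (forall x, F n x @[n --> \oo] --> f x) -> Q f.

(** The least limit-closed class of functions with values in [0, 1] that contains the [wC1] ones,
    encoded as the intersection of all such classes. *)
Let Phi (f : X -> R) := (forall x, 0 <= f x <= 1) /\
  forall Q, (forall h, wC1 h -> (forall x, 0 <= h x <= 1) -> Q h) ->
    limit_closed Q -> Q f.

Let Phi_wC1 f : wC1 f -> (forall x, 0 <= f x <= 1) -> Phi f.
Proof. by move=> wf f01; split => // Q h _; exact: h. Qed.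

Let Phi_lim F f : (forall n, Phi (F n)) ->
  (forall x, F n x @[n --> \oo] --> f x) -> Phi f.
Proof.
move=> PF Ff; split.
  move=> x; apply/andP; split.
    by apply: (cvgr_to_ge (Ff x)); apply: nearW => n; have [/(_ x)/andP[]] := PF n.
  by apply: (cvgr_to_le (Ff x)); apply: nearW => n; have [/(_ x)/andP[]] := PF n.
move=> Q h1 h2; apply: (h2 F f) => // n; first by have [_] := PF n; apply.
by have [] := PF n.
Qed.

Let Phi_onem f : Phi f -> Phi (fun x => 1 - f x).
Proof.
move=> [f01 Pf]; split; first by move=> x; have := f01 x; lra.
move=> Q h1 h2; apply: (Pf (fun f => Q (fun x => 1 - f x))).
  move=> h wh h01; apply: h1; first exact: (wC1_sub ipP (wC1_cst ipP _)).
  by move=> x; have := h01 x; lra.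
move=> F g FQ F01 Fg; apply: (h2 (fun n x => 1 - F n x)) => //.
  by move=> n x; have := F01 n x; lra.
by move=> x; apply: cvgB; [exact: cvg_cst|exact: Fg].
Qed.

(** The usual two rounds: one factor in [wC1] and the other in the class, then both in the class. *)
Let Phi_mul f g : Phi f -> Phi g -> Phi (fun x => f x * g x).
Proof.
have M01 (a b : R) : 0 <= a <= 1 -> 0 <= b <= 1 -> 0 <= a * b <= 1.
  by move=> /andP[a0 a1] /andP[b0 b1]; rewrite mulr_ge0//= mulr_ile1.
have lc h : (forall x, 0 <= h x <= 1) -> forall Q, limit_closed Q ->
    limit_closed (fun f => Q (fun x => h x * f x)).
  move=> h01 Q lQ F k FQ F01 Fk; apply: (lQ (fun n x => h x * F n x)) => //.
    by move=> n x; exact: M01.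
  by move=> x; apply: cvgMr; exact: Fk.
have step h : wC1 h -> (forall x, 0 <= h x <= 1) -> forall g, Phi g -> Phi (fun x => h x * g x).
  move=> wh h01 k [k01 Pk]; split; first by move=> x; exact: M01.
  move=> Q h1 h2; apply: (Pk (fun k => Q (fun x => h x * k x))); last exact: lc.
  move=> l wl l01; apply: h1; first exact: wC1_mul.
  by move=> x; exact: M01.
move=> [f01 Pf] Pg; have [g01 _] := Pg; split; first by move=> x; exact: M01.
move=> Q h1 h2; apply: (Pf (fun f => Q (fun x => f x * g x))).
  by move=> h wh h01; have [_] := step h wh h01 g Pg; apply.
move=> F k FQ F01 Fk; apply: (h2 (fun n x => F n x * g x)) => //.
  by move=> n x; exact: M01.
by move=> x; apply: cvgMl; exact: Fk.
Qed.

(** These polynomials replace [min 1 (n t)], which would leave C^1. *)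
Lemma cvg_one_sub_exp (t : R) : 0 <= t <= 1 ->
  (1 - (1 - t) ^+ n) @[n --> \oo] --> ((0 < t)%R%:R : R).
Proof.
move=> /andP[t0 t1]; have [tp|tn] := ltP 0 t.
  rewrite -[X in _ --> X]subr0; apply: cvgB; first exact: cvg_cst.
  by apply: cvg_expr; rewrite ger0_norm; lra.
have -> : t = 0 by apply/eqP; rewrite eq_le tn.
by under eq_cvg do rewrite subr0 expr1n subrr; exact: cvg_cst.
Qed.

(** The algebra takes place in [Phi]: complements are [1 - f], finite unions [1 - (1 - f) (1 - g)],
    countable unions are limits, and half-spaces come from [cvg_one_sub_exp]. Thus [Q] itself need
    not be stable under any of these operations. *)
Lemma monotone_class (Q : (X -> R) -> Prop) :
  (forall h, wC1 h -> (forall x, 0 <= h x <= 1) -> Q h) -> limit_closed Q ->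
  forall B : set (hs_XB X), measurable B -> Q \1_B.
Proof.
move=> QA lQ B mB.
suff : Phi (\1_B : X -> R) by move=> [_]; apply.
pattern B; apply: borel_induction mB.
- by rewrite indic0; apply: Phi_wC1; [exact: wC1_cst|move=> x; rewrite lexx ler01].
- move=> A /Phi_onem; congr Phi; apply/funext => x; rewrite !indicE in_setC.
  by case: (x \in A); rewrite ?subrr ?subr0.
- move=> F SF.
  have SU n : Phi (\1_(\big[setU/set0]_(i < n) F i) : X -> R).
    elim: n => [|n ih].
      by rewrite big_ord0 indic0; apply: Phi_wC1; [exact: wC1_cst|move=> x; rewrite lexx ler01].
    have := Phi_onem (Phi_mul (Phi_onem ih) (Phi_onem (SF n))).
    congr Phi; apply/funext => x; rewrite big_ord_recr/= !indicE in_setU.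
    by case: (_ \in _); case: (_ \in _); rewrite /= ?subrr ?subr0 ?mul0r ?mulr0 ?mul1r ?subrr ?subr0.
  apply: Phi_lim SU _ => x; rewrite indicE.
  have [[m _ Fm]|h] := pselect ((\bigcup_n F n) x).
    rewrite mem_set; last by exists m.
    apply: cvg_near_cst; exists m.+1 => // n /= mn; rewrite indicE mem_set//.
    by rewrite -bigcup_mkord; exists m.
  rewrite memNset//.
  apply: cvg_near_cst; apply: nearW => n; rewrite indicE memNset//.
  by rewrite -bigcup_mkord => -[m _ Fm]; apply: h; exists m.
- move=> z c; apply: (@Phi_lim (fun n x => 1 - (1 - halfspace_fun ip z c x) ^+ n)).
    move=> n; have h01 x : 0 <= halfspace_fun ip z c x <= 1.
      by rewrite plateau_ge0 plateau_le1.
    apply: Phi_wC1.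
      apply: wC1_sub => //; first exact: wC1_cst.
      apply: wC1_exp => //; apply: wC1_sub => //; first exact: wC1_cst.
      exact: wC1_halfspace.
    move=> x; have /andP[h0 h1] := h01 x.
    have e0 : 0 <= (1 - halfspace_fun ip z c x) ^+ n by rewrite exprn_ge0// subr_ge0.
    have e1 : (1 - halfspace_fun ip z c x) ^+ n <= 1.
      by rewrite exprn_ile1// ?subr_ge0// lerBlDr lerDl.
    by apply/andP; split; lra.
  move=> x; rewrite indicE.
  have -> : (x \in [set x | c < ip x z]) = (0 < halfspace_fun ip z c x).
    apply/idP/idP => [|h].
      by rewrite inE /= => h; apply: plateau_gt0; rewrite subr_gt0.
    rewrite inE /= ltNge; apply/negP => h'.
    by move: h; rewrite /halfspace_fun plateau_le0 ?ltxx// subr_le0.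
  by apply: cvg_one_sub_exp; rewrite plateau_ge0 plateau_le1.
Qed.
End monotone_class.

(** * A measure for the positive part of a bounded functional *)

Section daniell.
Variables (R : realType) (X : completeNormedModType R) (ip : X -> X -> R).
Hypothesis ipP : hs_is_inner_product ip.

Notation C1 := (C1 ip).
Notation wC1 := (wC1 ip).

(* Dini's theorem, balls being weakly compact. *)
Lemma dini_on_balls (K : nat -> X -> R) (delta r : R) :
  (forall n, weakly_continuous ip (K n)) ->
  (forall n x, K n.+1 x <= K n x) -> (forall x, exists n, K n x < delta) ->
  exists n, forall x, `|x| <= r -> K n x < delta.
Proof.
move=> Kw Kdec Kd; apply: contrapT => /forallNP h.
have hA n : exists x, `|x| <= r /\ delta <= K n x.
  have /existsNP[x /not_implyP[xr /negP]] := h n.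
  by rewrite -leNgt => hx; exists x.
have Kmono m n x : (m <= n)%N -> K n x <= K m x.
  move=> /subnKC <-; elim: (n - m)%N => [|k ih]; first by rewrite addn0.
  by rewrite addnS (le_trans (Kdec _ _)).
have /choice[a aP] := hA.
(* The counterexamples have a weak limit [w] along an ultrafilter; as [K] decreases in its index,
   [delta <= K n w] for every [n]. *)
pose F := a @ \oo.
have [G [UG FG]] := @ultraFilterLemma _ F _.
have Gr : G [set x | `|x| <= r].
  by apply: FG; exists 0%N => // n _; have [] := aP n.
have PG : ProperFilter G by exact: ultra_proper.
have FFG : Filter G by exact: filter_filter.
have [w Gw] := ball_weakly_compact ipP UG Gr.
have [n hn] := Kd w.
have hK : K n y @[y --> G] --> K n w := Kw n G w FFG Gw.
have : delta <= K n w.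
  apply: (cvgr_to_ge hK).
  apply: FG; exists n => // m /= nm.
  by have [_ hm] := aP m; apply: le_trans hm (Kmono _ _ _ nm).
by rewrite leNgt hn.
Qed.

Variables (L : (X -> R) -> R) (C : R).
Hypothesis C_ge0 : 0 <= C.
Hypothesis L_lin : forall a f g, C1 f -> C1 g ->
  L (fun x => a * f x + g x) = a * L f + L g.
Hypothesis L_bd : forall f M, C1 f -> (forall x, `|f x| <= M) -> L f <= C * M.
Hypothesis L_cut : forall f, C1 f ->
  L (fun x => f x * cutoff n x) @[n --> \oo] --> L f.

Let L0 : L (fun=> 0) = 0.
Proof.
have := L_lin 1 (C1_cst ipP 0) (C1_cst ipP 0).
have -> : (fun _ : X => 1 * 0 + 0 : R) = (fun=> 0) by apply/funext => x; rewrite mul1r addr0.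
lra.
Qed.

Let LD f g : C1 f -> C1 g -> L (fun x => f x + g x) = L f + L g.
Proof. by move=> hf hg; rewrite -[L f]mul1r -L_lin//; congr L; apply/funext => x; rewrite mul1r. Qed.

Let LZ a f : C1 f -> L (fun x => a * f x) = a * L f.
Proof.
move=> hf; rewrite -[RHS]addr0 -L0 -(L_lin _ hf (C1_cst ipP 0)).
by congr L; apply/funext => x; rewrite addr0.
Qed.

Let LB f g : C1 f -> C1 g -> L (fun x => f x - g x) = L f - L g.
Proof.
move=> hf hg; rewrite addrC -mulN1r -L_lin//.
by congr L; apply/funext => x; rewrite mulN1r addrC.
Qed.

(* Mass does not escape to infinity: take [S] of bounded support, [|S| <= 1],
   with [L S] nearly maximal; adding to it a function supported far away cannot
   increase [L] by more than [e]. *)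
Lemma functional_tight (e : R) : 0 < e -> exists n : nat, forall psi, C1 psi ->
  (forall x, `|psi x| <= 1) -> (forall x, `|x| ^+ 2 <= n%:R -> psi x = 0) ->
  L psi <= e.
Proof.
move=> e0.
pose adm n S := [/\ C1 S, forall x, `|S x| <= 1 & forall x, n%:R <= `|x| ^+ 2 -> S x = 0].
pose E := [set r | exists n S, adm n S /\ r = L S].
have hE : has_sup E.
  split.
    exists (L (fun=> 0)), 0%N, (fun=> 0); split => //.
    by split => //; [exact: C1_cst|move=> x; rewrite normr0].
  by exists (C * 1) => _ [n [S [[S1 S2 _] ->]]]; exact: L_bd.
have [_ [n [S [[S1 S2 S3] ->]]] hS] := sup_adherent e0 hE.
exists n => psi p1 p2 p3.
apply: (cvgr_to_le (L_cut p1)); apply: nearW => k.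
(* Beyond square radius [2 (k + 1)] the cutoff vanishes, so [N] bounds the supports of [S] and of
   the cut [psi]. *)
pose N := maxn n (2 * k.+1).
have pc := C1_mul ipP p1 (C1_cutoff ipP k).
have hN : E (L S + L (fun x => psi x * cutoff k x)).
  exists N, (fun x => S x + psi x * cutoff k x); split; last by rewrite LD.
  split; first exact: C1_add.
    move=> x; have [h|h] := leP (`|x| ^+ 2) n%:R.
      by rewrite p3// mul0r addr0.
    rewrite S3 ?(ltW h)// add0r normrM (ger0_norm (cutoff_ge0 _ _)).
    by rewrite mulr_ile1// ?cutoff_ge0// cutoff_le1.
  move=> x xN; rewrite S3 ?add0r; last first.
    by apply: le_trans xN; rewrite ler_nat leq_maxl.
  rewrite cutoff_out ?mulr0//; apply: le_trans xN.
  by rewrite -natrM ler_nat leq_maxr.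
have := ub_le_sup hE.2 hN; lra.
Qed.

(** The Riesz positive part of [L]. The competitors range over [C1] rather than [wC1], so that they
    may be multiplied by cutoffs. *)
Definition pos_part (f : X -> R) : R :=
  sup [set r | exists psi, C1 psi /\ (forall x, 0 <= psi x <= f x) /\ r = L psi].

Let pos_has_sup f M : (forall x, 0 <= f x) -> (forall x, f x <= M) ->
  has_sup [set r | exists psi, C1 psi /\ (forall x, 0 <= psi x <= f x) /\ r = L psi].
Proof.
move=> f0 fM; split.
  exists (L (fun=> 0)), (fun=> 0); split; first exact: C1_cst.
  by split => // x; rewrite lexx f0.
exists (C * M) => _ [psi [p1 [p2 ->]]]; apply: L_bd => // x.
by have /andP[h1 h2] := p2 x; rewrite ger0_norm// (le_trans h2).
Qed.

Lemma pos_part_ub f M psi : (forall x, f x <= M) -> C1 psi ->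
  (forall x, 0 <= psi x <= f x) -> L psi <= pos_part f.
Proof.
move=> fM p1 p2; apply: ub_le_sup; last by exists psi.
by apply: (pos_has_sup _ fM).2 => x; have /andP[] := p2 x; apply: le_trans.
Qed.

Lemma pos_part_le f r : (forall x, 0 <= f x) ->
  (forall psi, C1 psi -> (forall x, 0 <= psi x <= f x) -> L psi <= r) ->
  pos_part f <= r.
Proof.
move=> f0 h; apply: ge_sup; last by move=> _ [psi [p1 [p2 ->]]]; exact: h.
exists (L (fun=> 0)), (fun=> 0); split; first exact: C1_cst.
by split => // x; rewrite lexx f0.
Qed.

Lemma pos_part_ge0 f M : (forall x, 0 <= f x) -> (forall x, f x <= M) -> 0 <= pos_part f.
Proof.
move=> f0 fM; rewrite -L0; apply: (pos_part_ub fM); first exact: C1_cst.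
by move=> x; rewrite lexx f0.
Qed.

Lemma pos_part_bound f M : (forall x, 0 <= f x) -> (forall x, f x <= M) -> pos_part f <= C * M.
Proof.
move=> f0 fM; apply: pos_part_le => // psi p1 p2; apply: L_bd => // x.
by have /andP[h1 h2] := p2 x; rewrite ger0_norm// (le_trans h2).
Qed.

Lemma pos_part_mono f g M : (forall x, 0 <= f x <= g x) -> (forall x, g x <= M) ->
  pos_part f <= pos_part g.
Proof.
move=> fg gM; apply: pos_part_le; first by move=> x; have /andP[] := fg x.
move=> psi p1 p2; apply: (pos_part_ub gM) => // x.
by have /andP[h1 h2] := p2 x; have /andP[_ h3] := fg x; rewrite h1 (le_trans h2).
Qed.

Let C1_le f : C1 f -> exists M, forall x, f x <= M.
Proof.
move=> /C1_bounded[M _ h]; exists M => x; exact: le_trans (ler_norm _) (h x).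
Qed.

(** A competitor below [f = f1 + f2] is split with the weights [f_i f / (f^2 + d^2)], a
    regularisation of [f_i / f]. What is left, [psi d^2 / (f^2 + d^2)], is at most [d] since
    [f d <= f^2 + d^2], and contributes at most [C d <= e]. *)
Lemma pos_part_subadd f1 f2 : C1 f1 -> C1 f2 -> (forall x, 0 <= f1 x) -> (forall x, 0 <= f2 x) ->
  pos_part (fun x => f1 x + f2 x) <= pos_part f1 + pos_part f2.
Proof.
move=> h1 h2 f10 f20; apply: pos_part_le => [x|psi p1 p2]; first exact: addr_ge0.
have [M1 hM1] := C1_le h1; have [M2 hM2] := C1_le h2.
apply/ler_addgt0Pr => e e0.
pose d := e / (C + 1).
have C1p : 0 < C + 1 by rewrite ltr_wpDl.
have d0 : 0 < d by rewrite divr_gt0.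
have d20 : 0 < d ^+ 2 by rewrite exprn_gt0.
pose f x := f1 x + f2 x.
have f0 x : 0 <= f x by rewrite addr_ge0.
have hf : C1 f by exact: C1_add.
have den x : d ^+ 2 <= f x * f x + d ^+ 2 by rewrite lerDr mulr_ge0.
have dp x : 0 < f x * f x + d ^+ 2 by apply: lt_le_trans (den x).
pose q x := f x * (f x * f x + d ^+ 2)^-1.
have hden : C1 (fun x => f x * f x + d ^+ 2).
  exact: (C1_add ipP (C1_mul ipP hf hf) (C1_cst ipP _)).
have hq : C1 q.
  have [g hg] := hden; apply: (C1_mul ipP hf).
  by eexists; exact: (C1b_inv ipP d20 den hg).
have q0 x : 0 <= q x by rewrite mulr_ge0// invr_ge0 ltW.
have fq1 x : f x * q x <= 1.
  by rewrite /q mulrA ler_pdivrMr// mul1r lerDl ltW.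
have pq x : psi x * q x <= 1.
  by apply: le_trans (fq1 x); rewrite ler_wpM2r//; have /andP[] := p2 x.
have p0 x : 0 <= psi x by have /andP[] := p2 x.
have part g : C1 g -> (forall x, 0 <= g x) -> C1 (fun x => psi x * q x * g x) /\
    forall x, 0 <= psi x * q x * g x <= g x.
  move=> hg g0; split; first exact: (C1_mul ipP (C1_mul ipP p1 hq) hg).
  by move=> x; rewrite (mulr_ge0 (mulr_ge0 (p0 x) (q0 x)) (g0 x))/=; exact: ler_piMl (g0 x) (pq x).
have [a1 b1] := part f1 h1 f10; have [a2 b2] := part f2 h2 f20.
have l1 := pos_part_ub hM1 a1 b1; have l2 := pos_part_ub hM2 a2 b2.
pose rest x := psi x - (psi x * q x * f1 x + psi x * q x * f2 x).
have hr : C1 rest := C1_sub ipP p1 (C1_add ipP a1 a2).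
have rb x : `|rest x| <= d.
  have -> : rest x = psi x * (d ^+ 2 / (f x * f x + d ^+ 2)).
    by rewrite /rest /q -/(f x) -mulrDr -/(f x); field; rewrite gt_eqF.
  have k0 : 0 <= d ^+ 2 / (f x * f x + d ^+ 2) := divr_ge0 (ltW d20) (ltW (dp x)).
  rewrite (ger0_norm (mulr_ge0 (p0 x) k0)).
  apply: (@le_trans _ _ (f x * (d ^+ 2 / (f x * f x + d ^+ 2)))).
    by apply: ler_wpM2r => //; have /andP[] := p2 x.
  rewrite mulrA ler_pdivrMr//.
  have := sqr_ge0 (f x - d); have := f0 x; move: (f x) => y y0; nra.
have lr := L_bd hr rb.
have : L psi = L (fun x => psi x * q x * f1 x) + L (fun x => psi x * q x * f2 x) + L rest.
  by rewrite (LB p1 (C1_add ipP a1 a2)) (LD a1 a2); ring.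
have : C * d <= e.
  rewrite /d mulrA ler_pdivrMr// mulrC ler_wpM2l ?(ltW e0)// lerDl//.
lra.
Qed.

Lemma pos_part_superadd f1 f2 M : (forall x, 0 <= f1 x) -> (forall x, 0 <= f2 x) ->
  (forall x, f1 x + f2 x <= M) ->
  pos_part f1 + pos_part f2 <= pos_part (fun x => f1 x + f2 x).
Proof.
move=> f10 f20 fM; rewrite -lerBrDr; apply: pos_part_le => // psi1 p1 q1.
rewrite lerBrDr -lerBrDl; apply: pos_part_le => // psi2 p2 q2.
rewrite lerBrDl -(LD p1 p2); apply: (pos_part_ub fM); first exact: (C1_add ipP p1 p2).
move=> x; have /andP[a1 b1] := q1 x; have /andP[a2 b2] := q2 x.
by rewrite addr_ge0//= lerD.
Qed.

Lemma pos_part_add f1 f2 : C1 f1 -> C1 f2 -> (forall x, 0 <= f1 x) -> (forall x, 0 <= f2 x) ->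
  pos_part (fun x => f1 x + f2 x) = pos_part f1 + pos_part f2.
Proof.
move=> h1 h2 f10 f20; apply/eqP; rewrite eq_le pos_part_subadd//=.
have [M hM] := C1_le (C1_add ipP h1 h2).
exact: (pos_part_superadd f10 f20 hM).
Qed.

Lemma pos_part0 : pos_part (fun=> 0) = 0.
Proof.
apply/eqP; rewrite eq_le; apply/andP; split.
  by have := @pos_part_bound (fun=> 0) 0; rewrite mulr0; apply.
exact: (@pos_part_ge0 (fun=> 0) 0).
Qed.

Lemma pos_partZ a f : 0 <= a -> C1 f -> (forall x, 0 <= f x) ->
  pos_part (fun x => a * f x) <= a * pos_part f.
Proof.
move=> a0 hf f0; have [M hM] := C1_le hf.
have [->|an0] := eqVneq a 0.
  by rewrite mul0r; under eq_fun do rewrite mul0r; rewrite pos_part0.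
have ap : 0 < a by rewrite lt_def an0.
apply: pos_part_le => [x|psi p1 p2]; first exact: mulr_ge0.
rewrite mulrC -ler_pdivrMr// mulrC -(LZ _ p1).
apply: (pos_part_ub hM); first exact: (C1_mul ipP (C1_cst ipP _) p1).
move=> x; have /andP[h1 h2] := p2 x.
by rewrite mulr_ge0 ?invr_ge0//= mulrC ler_pdivrMr// mulrC.
Qed.

(* [s] is an upper bound of the Daniell outer integral of [phi]. *)
Definition bounds (phi : X -> R) (s : R) := exists H : nat -> X -> R,
  [/\ forall N, wC1 (H N), forall N x, 0 <= H N x, forall N x, H N x <= H N.+1 x,
    forall x d, 0 < d -> exists N, phi x - d <= H N x &
    forall N, pos_part (H N) <= s].

(** No cover can undercut the functional. Of a competitor [psi], the part far away is small by
    tightness; on a large ball Dini's theorem puts [phi] below [H N + d] for a single [N]. *)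
Lemma bounds_pos_part phi s : C1 phi -> weakly_continuous ip phi -> (forall x, 0 <= phi x) ->
  bounds phi s -> pos_part phi <= s.
Proof.
move=> p1 pw p0 [H [Hw H0 Hinc Hlim Hs]].
have [M0 M0p hM] := C1_bounded p1.
have pM x : phi x <= M0 by exact: le_trans (ler_norm _) (hM x).
apply/ler_addgt0Pr => e e0.
(* Tightness concerns functions bounded by 1, so the tail of [psi] is divided by [M0] before it is
   applied. *)
have [n hn] := functional_tight (divr_gt0 (divr_gt0 e0 (ltr0Sn R 1)) M0p).
have C1p : 0 < C + 1 by rewrite ltr_wpDl.
pose d := e / 2 / (C + 1).
have d0 : 0 < d by rewrite !divr_gt0.
(* Outside this ball [|x|^2 >= 2 (n + 1)], where [cutoff n] is 0. *)
have [N hN] : exists N, forall x, `|x| <= 2 * n.+1%:R -> phi x - H N x < d.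
  apply: dini_on_balls.
  - move=> k F w FF Fw; apply: cvgB; first exact: pw.
    by have [_ Hk] := Hw k; exact: Hk.
  - by move=> k x; rewrite lerB.
  - move=> x; have [k hk] := Hlim x (d / 2) (divr_gt0 d0 (ltr0Sn R 1)).
    by exists k; move: hk d0; lra.
apply: pos_part_le => // psi q1 q2.
have hc := C1_cutoff ipP n.
have a1 := C1_mul ipP q1 hc.
have a2 : C1 (fun x => M0^-1 * (psi x - psi x * cutoff n x)).
  exact: (C1_mul ipP (C1_cst ipP _) (C1_sub ipP q1 a1)).
have E1 : L psi = L (fun x => psi x * cutoff n x) + M0 * L (fun x => M0^-1 * (psi x - psi x * cutoff n x)).
  rewrite (LZ _ (C1_sub ipP q1 a1)) (LB q1 a1).
  by rewrite mulrA mulfV ?gt_eqF// mul1r addrC subrK.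
have E2 : L (fun x => M0^-1 * (psi x - psi x * cutoff n x)) <= e / 2 / M0.
  apply: hn => // x.
    have /andP[h1 h2] := q2 x.
    have c0 := cutoff_ge0 n x; have c1 := cutoff_le1 n x.
    rewrite ger0_norm; last first.
      by rewrite mulr_ge0 ?invr_ge0 ?(ltW M0p)// subr_ge0 ler_piMr.
    rewrite mulrC ler_pdivrMr// mul1r.
    by apply: le_trans (le_trans h2 (pM x)); rewrite lerBlDr lerDl mulr_ge0.
  move=> hx; have hx' : `|x| ^+ 2 <= n.+1%:R by apply: le_trans hx _; rewrite ler_nat.
  have [-> _] := cutoff_in hx'.
  by rewrite mulr1 subrr mulr0.
have E3 : L (fun x => psi x * cutoff n x) <= pos_part (fun x => H N x + d).
  have [M1 hM1] := C1_le (wC1_C1 (wC1_add ipP (Hw N) (wC1_cst ipP d))).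
  apply: (pos_part_ub hM1) => // x.
  have /andP[h1 h2] := q2 x.
  have c0 := cutoff_ge0 n x; have c1 := cutoff_le1 n x.
  rewrite mulr_ge0//=.
  have [hx|hx] := leP `|x| (2 * n.+1%:R).
    have hd := hN x hx; apply: (@le_trans _ _ (psi x)); first by rewrite ler_piMr.
    by move: hd h2; lra.
  rewrite cutoff_out ?mulr0; first by rewrite addr_ge0 ?(ltW d0).
  have n1 : 1 <= n.+1%:R :> R by rewrite ler1n.
  by have := normr_ge0 x; move: hx n1; nra.
have E4 : pos_part (fun x => H N x + d) <= s + C * d.
  apply: (le_trans (pos_part_subadd (wC1_C1 (Hw N)) (C1_cst ipP d) (H0 N) (fun=> ltW d0))).
  by rewrite lerD// pos_part_bound// => _; exact: ltW.
have E5 : C * d <= e / 2.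
  rewrite /d mulrA ler_pdivrMr// mulrC ler_wpM2l ?lerDl// ltW// divr_gt0//.
have E6 : M0 * L (fun x => M0^-1 * (psi x - psi x * cutoff n x)) <= e / 2.
  by rewrite mulrC -ler_pdivlMr.
rewrite E1; lra.
Qed.

Lemma bounds_self f : wC1 f -> (forall x, 0 <= f x) -> bounds f (pos_part f).
Proof.
move=> wf f0; exists (fun=> f); split => // x d d0; exists 0%N; lra.
Qed.

Lemma bounds_le phi phi' s s' : (forall x, phi' x <= phi x) -> s <= s' ->
  bounds phi s -> bounds phi' s'.
Proof.
move=> pp ss [H [Hw H0 Hinc Hlim Hs]]; exists H; split => //.
  by move=> x d d0; have [N hN] := Hlim x d d0; exists N; have := pp x; lra.
by move=> N; exact: le_trans ss.
Qed.

Let incr (H : nat -> X -> R) : (forall N x, H N x <= H N.+1 x) ->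
  forall m n x, (m <= n)%N -> H m x <= H n x.
Proof.
move=> Hinc m n x /subnKC <-; elim: (n - m)%N => [|k ih]; first by rewrite addn0.
by rewrite addnS (le_trans ih).
Qed.

Lemma bounds_add phi1 phi2 s1 s2 : bounds phi1 s1 -> bounds phi2 s2 ->
  bounds (fun x => phi1 x + phi2 x) (s1 + s2).
Proof.
move=> [H [Hw H0 Hinc Hlim Hs]] [H' [Hw' H0' Hinc' Hlim' Hs']].
exists (fun N x => H N x + H' N x); split.
- by move=> N; exact: (wC1_add ipP (Hw N) (Hw' N)).
- by move=> N x; exact: addr_ge0.
- by move=> N x; exact: lerD.
- move=> x d d0; have d20 : 0 < d / 2 by rewrite divr_gt0.
  have [N hN] := Hlim x _ d20; have [N' hN'] := Hlim' x _ d20.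
  exists (maxn N N').
  have := incr Hinc x (leq_maxl N N'); have := incr Hinc' x (leq_maxr N N').
  by move: hN hN'; lra.
- move=> N; rewrite pos_part_add//; [exact: lerD|exact: (wC1_C1 (Hw N))|exact: (wC1_C1 (Hw' N))].
Qed.

Lemma boundsZ a phi s : 0 <= a -> bounds phi s -> bounds (fun x => a * phi x) (a * s).
Proof.
move=> a0 [H [Hw H0 Hinc Hlim Hs]]; exists (fun N x => a * H N x); split.
- by move=> N; exact: (wC1_mul ipP (wC1_cst ipP _) (Hw N)).
- by move=> N x; exact: mulr_ge0.
- by move=> N x; exact: ler_wpM2l.
- move=> x d d0; have a1 : 0 < a + 1 by rewrite ltr_wpDl.
  have [N hN] := Hlim x _ (divr_gt0 d0 a1); exists N.
  have : a * (phi x - d / (a + 1)) <= a * H N x by exact: ler_wpM2l.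
  have : a * (d / (a + 1)) <= d.
    by rewrite mulrA ler_pdivrMr// mulrC ler_wpM2l ?(ltW d0)// lerDl.
  by rewrite mulrBr; lra.
- move=> N; apply: le_trans (pos_partZ a0 (wC1_C1 (Hw N)) (H0 N)) _.
  exact: ler_wpM2l.
Qed.

Lemma bounds0 : bounds (fun=> 0) 0.
Proof.
have := @bounds_self (fun=> 0) (wC1_cst ipP 0) (fun=> lexx 0).
by rewrite pos_part0.
Qed.

Lemma bounds_ge0 phi s : bounds phi s -> 0 <= s.
Proof.
move=> [H [Hw H0 _ _ /(_ 0%N)]]; apply: le_trans.
by have [M hM] := C1_le (wC1_C1 (Hw 0%N)); exact: (pos_part_ge0 (H0 0%N) hM).
Qed.

Lemma bounds_bigcup (A : nat -> set X) (s : nat -> R) (T : R) :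
  (forall n, bounds \1_(A n) (s n)) -> (forall n, \sum_(i < n) s i <= T) ->
  bounds \1_(\bigcup_n A n) T.
Proof.
move=> /choice[H HP] sT.
have Hw n N : wC1 (H n N) by have [] := HP n.
have H0 n N x : 0 <= H n N x by have [] := HP n.
have Hi n N x : H n N x <= H n N.+1 x by have [] := HP n.
have Hs n N : pos_part (H n N) <= s n by have [] := HP n.
have sumP N M : pos_part (fun x => \sum_(i < M) H i N x) <= \sum_(i < M) s i.
  elim: M => [|M ih].
    by under eq_fun do rewrite big_ord0; rewrite big_ord0 pos_part0.
  under eq_fun do rewrite big_ord_recr /=; rewrite big_ord_recr /= pos_part_add.
  - exact: lerD.
  - exact: (wC1_C1 (wC1_sum ipP _ (fun i => Hw i N))).
  - exact: (wC1_C1 (Hw M N)).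
  - by move=> x; apply: sumr_ge0.
  - by [].
(* The diagonal sequence increases twice over: more terms, and larger ones. *)
exists (fun N x => \sum_(i < N) H i N x); split.
- by move=> N; exact: (wC1_sum ipP N (fun i => Hw i N)).
- by move=> N x; apply: sumr_ge0.
- move=> N x; rewrite big_ord_recr /= -[X in X <= _]addr0 lerD//.
  by apply: ler_sum.
- move=> x d d0; rewrite indicE.
  have [[n _ An]|h] := pselect ((\bigcup_n A n) x); last first.
    by exists 0%N; rewrite memNset// sub0r big_ord0 lerNl oppr0 ltW.
  rewrite mem_set; last by exists n.
  have [_ _ _ /(_ x d d0)[N hN] _] := HP n.
  rewrite indicE mem_set// in hN.
  exists (maxn n.+1 N); apply: (le_trans hN).
  apply: (le_trans (incr (Hi n) x (leq_maxr n.+1 N))).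
  have nm : (n < maxn n.+1 N)%N by rewrite leq_max leqnn.
  by rewrite (bigD1 (Ordinal nm))//= lerDl sumr_ge0.
- by move=> N; exact: le_trans (sumP N N) (sT N).
Qed.

(* Caratheodory's condition for [0 < g], with the covers cut by
   [1 - (1 - g)^N], which increases to the indicator function. *)
Lemma bounds_split (g : X -> R) (A : set X) (s e : R) : wC1 g -> (forall x, 0 <= g x <= 1) ->
  0 < e -> bounds \1_A s -> exists s1 s2, [/\ bounds \1_(A `&` [set x | 0 < g x]) s1,
    bounds \1_(A `&` ~` [set x | 0 < g x]) s2 & s1 + s2 <= s + e].
Proof.
move=> wg g01 e0 [H [Hw H0 Hinc Hlim Hs]].
pose chi N x := 1 - (1 - g x) ^+ N.
have gx x : 0 <= 1 - g x <= 1 by have := g01 x; lra.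
have chi0 N x : 0 <= chi N x.
  by rewrite subr_ge0 exprn_ile1//; have /andP[] := gx x.
have chi1 N x : chi N x <= 1.
  by rewrite lerBlDr lerDl exprn_ge0//; have /andP[] := gx x.
have chiS N x : chi N x <= chi N.+1 x.
  rewrite lerB// exprS ler_piMl// ?exprn_ge0//; by have /andP[] := gx x.
have chig N x : g x <= 0 -> chi N x = 0.
  move=> gx0; have /andP[g0 _] := g01 x.
  have gE : g x = 0 by apply/eqP; rewrite eq_le gx0.
  by rewrite /chi gE subr0 expr1n subrr.
have wchi N : wC1 (chi N).
  exact: (wC1_sub ipP (wC1_cst ipP 1) (wC1_exp ipP N (wC1_sub ipP (wC1_cst ipP 1) wg))).
have wHc N J : wC1 (fun x => H N x * chi J x) := wC1_mul ipP (Hw N) (wchi J).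
have wHc' N J : wC1 (fun x => H N x * (1 - chi J x)) :=
  wC1_mul ipP (Hw N) (wC1_sub ipP (wC1_cst ipP 1) (wchi J)).
have Hc0 N J x : 0 <= H N x * chi J x by rewrite mulr_ge0.
have Hc0' N J x : 0 <= H N x * (1 - chi J x) by rewrite mulr_ge0// subr_ge0.
have Hadd N J : pos_part (fun x => H N x * chi J x) + pos_part (fun x => H N x * (1 - chi J x)) = pos_part (H N).
  rewrite -pos_part_add//; [|exact: (wC1_C1 (wHc _ _))|exact: (wC1_C1 (wHc' _ _))].
  by congr pos_part; apply/funext => x; ring.
have posM f h : wC1 h -> (forall x, 0 <= f x <= h x) -> pos_part f <= pos_part h.
  by move=> wh fh; have [M hM] := C1_le (wC1_C1 wh); exact: (pos_part_mono fh hM).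
have pos0 h : wC1 h -> (forall x, 0 <= h x) -> 0 <= pos_part h.
  by move=> wh h0; have [M hM] := C1_le (wC1_C1 wh); exact: (pos_part_ge0 h0 hM).
pose p N := pos_part (fun x => H N x * chi N x).
pose E := range p.
have hE : has_sup E.
  split; first by exists (p 0%N), 0%N.
  exists s => _ [N _ <-]; apply: le_trans (Hs N); rewrite -(Hadd N N) lerDl.
  exact: pos0.
have [_ [J _ <-] hJ] := sup_adherent e0 hE.
(* The cut masses [p N] have supremum [s1], and [s2] is what a nearly optimal [p J] leaves of [s].
   The index [J] stays fixed in the second cover because [1 - chi N] decreases in [N]; off [0 < g]
   it equals 1 for any index. *)
exists (sup E), (s - p J); split; last by move: hJ; lra.
- exists (fun N x => H N x * chi N x); split => //.
  + by move=> N x; rewrite ler_pM.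
  + move=> x d d0; rewrite indicE; have [[Ax /= gx0]|h] := pselect ((A `&` [set x | 0 < g x]) x); last first.
      by rewrite memNset//; exists 0%N; apply: le_trans (Hc0 0%N 0%N x); rewrite sub0r lerNl oppr0 ltW.
    rewrite mem_set//.
    have d20 : 0 < d / 2 by rewrite divr_gt0.
    have [N] := Hlim x _ d20; rewrite indicE mem_set// => hN.
    have : chi n x @[n --> \oo] --> (1 : R) by have := cvg_one_sub_exp (g01 x); rewrite gx0.
    move=> /cvgr_gt /(_ (1 - d / 2)) []; first by lra.
    move=> N' _ /(_ (maxn N N') (leq_maxr _ _)) /= hN'.
    exists (maxn N N').
    have hN2 := incr Hinc x (leq_maxl N N').
    have := chi0 (maxn N N') x; have := chi1 (maxn N N') x; have := H0 (maxn N N') x.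
    move: hN hN' hN2; move: (chi _ x) (H (maxn _ _) x) (H N x) => a b c.
    move=> h1' h2 h3 h4 h5 h6; have h1 : 1 - d / 2 <= c := h1'.
    have h7 : 1 - d / 2 <= b by lra.
    (* Both factors are at least [1 - d / 2], with product at least [1 - d] if [d <= 1]; otherwise
       [1 - d] is negative. *)
    have [dd|dd] := leP d 1; last by have : 0 <= b * a := mulr_ge0 h4 h6; lra.
    have : (1 - d / 2) * (1 - d / 2) <= b * a by rewrite ler_pM//; lra.
    nra.
  + by move=> N; apply: ub_le_sup; [exact: hE.2|exists N].
- exists (fun N x => H N x * (1 - chi J x)); split => //.
  + by move=> N x; rewrite ler_wpM2r// subr_ge0.
  + move=> x d d0; rewrite indicE; have [[Ax /= /negP]|h] := pselect ((A `&` ~` [set x | 0 < g x]) x); last first.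
      by rewrite memNset//; exists 0%N; apply: le_trans (Hc0' 0%N J x); rewrite sub0r lerNl oppr0 ltW.
    rewrite -leNgt => gx0; rewrite mem_set; last by split => //=; apply/negP; rewrite -leNgt.
    have [N] := Hlim x _ d0; rewrite indicE mem_set// => hN; exists N.
    by rewrite chig// subr0 mulr1.
  + move=> N; pose N' := maxn N J.
    apply: (@le_trans _ _ (pos_part (fun x => H N' x * (1 - chi J x)))).
      apply: posM => // x; rewrite Hc0'/= ler_wpM2r ?subr_ge0//.
      exact: (incr Hinc x (leq_maxl N J)).
    have h1 := Hadd N' J; have h2 := Hs N'.
    have h3 : p J <= pos_part (fun x => H N' x * chi J x).
      apply: posM => // x; rewrite Hc0/= ler_wpM2r//.
      exact: (incr Hinc x (leq_maxr N J)).
    lra.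
Qed.

Definition outer_bound (A : set X) : R := inf [set s | bounds \1_A s].

Let C1p : 0 <= pos_part (fun=> 1) /\ wC1 (fun=> 1).
Proof.
split; last exact: wC1_cst.
exact: (@pos_part_ge0 (fun=> 1) 1).
Qed.

Let bounds1 A : bounds \1_A (pos_part (fun=> 1)).
Proof.
apply: (bounds_le _ (lexx _) (bounds_self C1p.2 (fun=> ler01))) => x.
by rewrite indicE; case: (_ \in _).
Qed.

Let ob_has_inf A : has_inf [set s | bounds \1_A s].
Proof.
by split; [exists (pos_part (fun=> 1)); exact: bounds1|exists 0 => s; exact: bounds_ge0].
Qed.

Let ob_le A s : bounds \1_A s -> outer_bound A <= s.
Proof. by move=> h; apply: ge_inf => //; exact: (ob_has_inf A).2. Qed.

Let ob_adh A e : 0 < e -> exists2 s, bounds \1_A s & s < outer_bound A + e.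
Proof. by move=> e0; have [s h1 h2] := inf_adherent e0 (ob_has_inf A); exists s. Qed.

Let ob_ge0 A : 0 <= outer_bound A.
Proof. by apply: lb_le_inf; [exact: (ob_has_inf A).1|move=> s; exact: bounds_ge0]. Qed.

Let om (A : set X) : \bar R := (outer_bound A)%:E.

Let om0 : om set0 = 0%E.
Proof.
congr EFin; apply/eqP; rewrite eq_le ob_ge0 andbT; apply: ob_le.
by rewrite indic0; exact: bounds0.
Qed.

Let om_ge0 A : (0 <= om A)%E. Proof. by rewrite lee_fin ob_ge0. Qed.

Let om_le : {homo om : A B / A `<=` B >-> (A <= B)%E}.
Proof.
move=> A B AB; rewrite lee_fin; apply: lb_le_inf; first exact: (ob_has_inf B).1.
move=> s hs; apply: ob_le; apply: (bounds_le _ (lexx s) hs) => x.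
rewrite !indicE ler_nat; case: (boolP (x \in A)) => // /set_mem /AB h.
by rewrite mem_set.
Qed.

Let om_sigma : sigma_subadditive om.
Proof.
move=> A.
have [->|/eqP foo] := pselect ((\sum_(i <oo) om (A i) = +oo)%E); first exact: leey.
have s0 : (0 <= \sum_(i <oo) om (A i))%E by apply: nneseries_ge0 => n _ _.
have fin : (\sum_(i <oo) om (A i))%E \is a fin_num by rewrite ge0_fin_numE// ltey.
rewrite -(fineK fin) lee_fin; apply/ler_addgt0Pr => e e0.
have ek n : 0 < e / (2 ^ n.+1)%:R by rewrite divr_gt0// ltr0n expn_gt0.
have /choice[s hs] : forall n, exists s, bounds \1_(A n) s /\ s < outer_bound (A n) + e / (2 ^ n.+1)%:R.
  by move=> n; have [s h1 h2] := ob_adh (A n) (ek n); exists s.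
apply: ob_le; apply: (@bounds_bigcup _ s) => n; first by have [] := hs n.
apply: (@le_trans _ _ (\sum_(i < n) (outer_bound (A i) + e / (2 ^ i.+1)%:R))).
  by apply: ler_sum => i _; have [_ /ltW] := hs i.
rewrite big_split /= lerD//.
  rewrite -lee_fin fineK// -sumEFin.
  have := @nneseries_lim_ge R (fun i => om (A i)) xpredT 0%N n (fun i _ _ => om_ge0 (A i)).
  by rewrite big_mkord.
have -> : \sum_(i < n) e / (2 ^ i.+1)%:R = e * (1 - (2 ^ n)%:R^-1).
  elim: n => [|n ih]; first by rewrite big_ord0 expn0 invr1 subrr mulr0.
  rewrite big_ord_recr /= ih expnS natrM.
  have p2 : (2 ^ n)%:R != 0 :> R by rewrite pnatr_eq0 expn_eq0.
  by field.
by rewrite ler_piMr ?(ltW e0)// lerBlDr lerDl invr_ge0.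
Qed.

Hypothesis sep : hs_separable_space X.

Let open_halfspace z c : set X := [set x | c < ip x z].

Let om_caratheodory_open z c A :
  (om (A `&` open_halfspace z c) + om (A `&` ~` open_halfspace z c) <= om A)%E.
Proof.
 rewrite -EFinD lee_fin; apply/ler_addgt0Pr => e e0.
have e2 : 0 < e / 2 by rewrite divr_gt0.
have [s hs1 hs2] := ob_adh A e2.
have h01 x : 0 <= halfspace_fun ip z c x <= 1 by rewrite plateau_ge0 plateau_le1.
have E : open_halfspace z c = [set x | 0 < halfspace_fun ip z c x].
  apply/seteqP; split => x /= h; first by apply: plateau_gt0; rewrite subr_gt0.
  rewrite /open_halfspace /= ltNge; apply/negP => h'; move: h.
  by rewrite /halfspace_fun plateau_le0 ?ltxx// subr_le0.
have [s1 [s2 [b1 b2 b3]]] := bounds_split (wC1_halfspace ipP z c) h01 e2 hs1.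
rewrite E; have := ob_le b1; have := ob_le b2; lra.
Qed.

Let om_outer := isOuterMeasure.Build R X om om0 om_ge0 om_le om_sigma.
Let omM : {outer_measure set X -> \bar R} := HB.pack om om_outer.

(** Caratheodory-measurable sets form a sigma-algebra, so half-spaces are enough. *)
Let om_borel (B : set (hs_XB X)) : measurable B -> omM.-caratheodory B.
Proof.
apply: (borel_induction ipP sep).
- exact: caratheodory_measurable_set0.
- exact: caratheodory_measurable_setC.
- exact: caratheodory_measurable_bigcup.
- by move=> z c; apply: le_caratheodory_measurable; exact: om_caratheodory_open.
Qed.

Let mu0 : (om : set (hs_XB X) -> \bar R) set0 = 0%E. Proof. exact: om0. Qed.
Let mu_ge0 (A : set (hs_XB X)) : (0 <= om A)%E. Proof. exact: om_ge0. Qed.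
Let mu_sigma : semi_sigma_additive (om : set (hs_XB X) -> \bar R).
Proof.
move=> F mF tF mUF.
apply: (@caratheodory_measure_sigma_additive R X omM F) => //.
- by move=> i; exact: om_borel.
- exact: om_borel.
Qed.
Let mu_isM := @isMeasure.Build _ (hs_XB X) R om mu0 mu_ge0 mu_sigma.
Let muM : {measure set (hs_XB X) -> \bar R} := HB.pack om mu_isM.
Let mu_fin : fin_num_fun (muM : set (hs_XB X) -> \bar R). Proof. by []. Qed.
Let mu_isF := @Measure_isFinite.Build _ (hs_XB X) R muM mu_fin.
Let mu : {finite_measure set (hs_XB X) -> \bar R} := HB.pack (Measure.sort muM) mu_isF.

(** The sum is the minimum of [k] and the integer part of [y]. *)
Lemma staircase (k : nat) (y : R) : 0 <= y ->
  [/\ \sum_(j < k) (j.+1%:R <= y)%R%:R <= y, \sum_(j < k) (j.+1%:R <= y)%R%:R <= k%:R :> R,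
    k%:R <= y -> k%:R <= \sum_(j < k) (j.+1%:R <= y)%R%:R :> R &
    y <= k%:R -> y <= 1 + \sum_(j < k) (j.+1%:R <= y)%R%:R].
Proof.
move=> y0; elim: k => [|k [h1 h2 h3 h4]].
  rewrite big_ord0; split => // h; lra.
rewrite big_ord_recr /= -natr1; set S := \sum_(j < k) _ in h1 h2 h3 h4 *.
have [h|h] := leP (k%:R + 1) y; rewrite ?addr0 /=; split => //; try lra.
Qed.

Let mu_integrable f M : measurable_fun [set: hs_XB X] (f : hs_XB X -> R) ->
  (forall x, `|f x| <= M) -> mu.-integrable setT (EFin \o f).
Proof. exact: bounded_integrable. Qed.

(** Layer-cake argument: the staircase [St] over the level sets satisfies [St <= f <= q + St] with
    [q = 1 / (k + 1)]. Its integral is below that of [f], while [q + St] is covered at nearly the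
    cost [q * pos_part 1] plus that integral. *)
Let pos_part_le_int f : wC1 f -> (forall x, 0 <= f x <= 1) -> pos_part f <= \int[mu]_x f x.
Proof.
move=> wf f01.
have mf : measurable_fun [set: hs_XB X] (f : hs_XB X -> R) by exact: (C1_measurable (wC1_C1 wf)).
have main (k : nat) e : 0 < e ->
    pos_part f <= \int[mu]_x f x + (k.+1%:R^-1 * pos_part (fun=> 1) + e).
  move=> e0; pose q : R := k.+1%:R^-1.
  have k0 : 0 < k.+1%:R :> R by rewrite ltr0n.
  have q0 : 0 < q by rewrite invr_gt0.
  pose B j := [set x : X | j.+1%:R <= k.+1%:R * f x].
  have mB j : measurable (B j : set (hs_XB X)).
    have : measurable_fun [set: hs_XB X] (fun x : hs_XB X => k.+1%:R * f x) by exact: measurable_funM.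
    move=> /(_ measurableT `[j.+1%:R, +oo[%classic (measurable_itv _)).
    by rewrite setTI; congr measurable; apply/seteqP; split => x /=; rewrite in_itv /= andbT.
  pose St n x : R := \sum_(j < n) q * \1_(B j) x.
  have StE n x : St n x = q * \sum_(j < n) (j.+1%:R <= k.+1%:R * f x)%R%:R.
    rewrite mulr_sumr; apply: eq_bigr => j _; rewrite indicE; congr (_ * _%:R).
    by have [h|h] := boolP (_ <= _); [rewrite mem_set|rewrite memNset//; exact/negP].
  have kf x : 0 <= k.+1%:R * f x <= k.+1%:R.
    have /andP[a b] := f01 x; rewrite mulr_ge0//= ler_piMr//.
  have St1 x : St k.+1 x <= f x.
    rewrite StE mulrC ler_pdivrMr// (mulrC (f x)).
    by have /andP[a b] := kf x; have [] := staircase k.+1 a.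
  have St2 x : f x <= q * 1 + St k.+1 x.
    rewrite StE -mulrDr mulrC ler_pdivlMr// (mulrC (f x)).
    by have /andP[a b] := kf x; have [_ _ _] := staircase k.+1 a; apply.
  have mSt n : measurable_fun [set: hs_XB X] (St n : hs_XB X -> R).
    apply: measurable_sum => j; apply: measurable_funM => //; exact: measurable_indic.
  have bSt n x : `|St n x| <= q * n%:R.
    have /andP[a b] := kf x; have [_ h _ _] := staircase n a.
    rewrite StE ger0_norm ?mulr_ge0 ?(ltW q0)//; last by apply: sumr_ge0.
    by apply: ler_wpM2l => //; exact: ltW.
  have iSt n : \int[mu]_x St n x = q * \sum_(j < n) outer_bound (B j).
    elim: n => [|n ih].
      rewrite big_ord0 mulr0 /St; under eq_Rintegral do rewrite big_ord0.
      by rewrite Rintegral_cst// mul0r.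
    have E : St n.+1 = fun x => St n x + q * \1_(B n) x.
      by apply/funext => x; rewrite /St big_ord_recr.
    rewrite E big_ord_recr mulrDr /= -ih.
    have i1 : mu.-integrable setT (EFin \o (\1_(B n) : hs_XB X -> R)).
      apply: (@mu_integrable _ 1); first exact: measurable_indic.
      by move=> x; rewrite indicE; case: (_ \in _); rewrite ?normr1 ?normr0.
    rewrite RintegralD//; last 2 first.
      exact: (mu_integrable (mSt n) (bSt n)).
      apply: (@mu_integrable _ q); first by apply: measurable_funM => //; exact: measurable_indic.
      move=> x; rewrite indicE; case: (_ \in _); rewrite ?mulr1 ?mulr0 ?normr0 ?(ltW q0)//.
      by rewrite gtr0_norm.
    rewrite RintegralZl//; congr (_ + _ * _).
    by rewrite /Rintegral integral_indic// setIT.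
  have iSf : \int[mu]_x St k.+1 x <= \int[mu]_x f x.
    apply: le_Rintegral => //.
    - exact: (mu_integrable (mSt _) (bSt _)).
    - apply: (@mu_integrable _ 1) => // x.
      by have /andP[a b] := f01 x; rewrite ger0_norm.
  (* Each level set is covered up to [e]; [k + 1] levels of weight [1 / (k + 1)] accumulate an error
     [e]. *)
  have bS n : bounds (St n) (q * \sum_(j < n) (outer_bound (B j) + e)).
    elim: n => [|n ih].
      by rewrite big_ord0 mulr0 /St; under eq_fun do rewrite big_ord0; exact: bounds0.
    rewrite big_ord_recr mulrDr /St; under eq_fun do rewrite big_ord_recr /=.
    apply: bounds_add => //; have [s hs /ltW h] := ob_adh (B n) e0.
    apply: (bounds_le (fun=> lexx _) _ (boundsZ (ltW q0) hs)).
    exact: ler_wpM2l (ltW q0) _ _ h.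
  have b1 : bounds (fun=> q * 1) (q * pos_part (fun=> 1)).
    exact: (boundsZ (ltW q0) (bounds_self C1p.2 (fun=> ler01))).
  have bf := bounds_le St2 (lexx _) (bounds_add b1 (bS k.+1)).
  have f0 x : 0 <= f x by have /andP[] := f01 x.
  have := bounds_pos_part (wC1_C1 wf) wf.2 f0 bf.
  rewrite big_split /= mulrDr -iSt sumr_const card_ord.
  have -> : q * (e *+ k.+1) = e by rewrite -mulr_natr mulrCA /q mulVf ?mulr1// gt_eqF.
  rewrite -/q; lra.
apply/ler_addgt0Pr => e e0.
have [k hk] : exists k, (k.+1%:R^-1 : R) < e / 2 / (pos_part (fun=> 1) + 1).
  have := @cvg_harmonic R; move=> /cvgr_lt /(_ (e / 2 / (pos_part (fun=> 1) + 1))).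
  case; first by rewrite !divr_gt0// ltr_wpDl// C1p.1.
  by move=> N _ hN; exists N; exact: (hN N (leqnn N)).
have := main k (e / 2) (divr_gt0 e0 (ltr0Sn R 1)).
have : k.+1%:R^-1 * pos_part (fun=> 1) <= e / 2.
  have P1 : 0 < pos_part (fun=> 1) + 1 by rewrite ltr_wpDl// C1p.1.
  rewrite ltr_pdivlMr// in hk; apply: le_trans (ltW hk).
  by rewrite ler_wpM2l// lerDl.
by move=> h1 h2; apply: (le_trans h2); rewrite lerD2l [leRHS]splitr lerD2r.
Qed.

(** The inequality missing for [f] is the known one for [1 - f], since the total mass is at most
    [pos_part 1], which is [pos_part f + pos_part (1 - f)]. *)
Lemma pos_part_measure : exists mu : {finite_measure set (hs_XB X) -> \bar R},
  forall f, wC1 f -> (forall x, 0 <= f x <= 1) -> \int[mu]_x f x = pos_part f.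
Proof.
exists mu => f wf f01; apply/eqP; rewrite eq_le pos_part_le_int// andbT.
have wg : wC1 (fun x => 1 - f x) := wC1_sub ipP (wC1_cst ipP 1) wf.
have g01 x : 0 <= 1 - f x <= 1 by have := f01 x; lra.
have := pos_part_le_int wg g01.
have hi (h : X -> R) : wC1 h -> (forall x, 0 <= h x <= 1) -> mu.-integrable setT (EFin \o (h : hs_XB X -> R)).
  move=> wh h01; apply: (@mu_integrable _ 1); first exact: (C1_measurable (wC1_C1 wh)).
  by move=> x; have /andP[a b] := h01 x; rewrite ger0_norm.
have i1 : mu.-integrable setT (EFin \o ((fun=> 1) : hs_XB X -> R)).
  by apply: hi; [exact: wC1_cst|move=> x; rewrite ler01 lexx].
rewrite RintegralB//; last exact: hi.
rewrite Rintegral_cst// mul1r.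
have : fine (mu setT) <= pos_part (fun=> 1) by apply: ob_le; exact: bounds1.
have : pos_part (fun=> 1) = pos_part f + pos_part (fun x => 1 - f x).
  rewrite -pos_part_add; first by congr pos_part; apply/funext => x; rewrite addrC subrK.
  - exact: wC1_C1.
  - exact: wC1_C1.
  - by move=> x; have /andP[] := f01 x.
  - by move=> x; have /andP[] := g01 x.
lra.
Qed.
End daniell.

(** * Jordan decomposition of a bounded functional *)

Section representation.
Variables (R : realType) (X : completeNormedModType R) (ip : X -> X -> R).
Hypothesis ipP : hs_is_inner_product ip.
Hypothesis sep : hs_separable_space X.
Notation C1 := (C1 ip).
Notation wC1 := (wC1 ip).

Lemma functional_representation (L : (X -> R) -> R) (C : R) : 0 <= C ->
  (forall a f g, C1 f -> C1 g -> L (fun x => a * f x + g x) = a * L f + L g) ->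
  (forall f M, C1 f -> (forall x, `|f x| <= M) -> L f <= C * M) ->
  (forall f, C1 f -> L (fun x => f x * cutoff n x) @[n --> \oo] --> L f) ->
  exists mu1 mu2 : {finite_measure set (hs_XB X) -> \bar R},
    forall f, wC1 f -> L f = \int[mu1]_x f x - \int[mu2]_x f x.
Proof.
move=> C0 Llin Lbd Lcut.
pose N f := - L f.
have Nlin a f g : C1 f -> C1 g -> N (fun x => a * f x + g x) = a * N f + N g.
  by move=> hf hg; rewrite /N Llin//; ring.
have Nbd f M : C1 f -> (forall x, `|f x| <= M) -> N f <= C * M.
  move=> hf fM; rewrite /N.
  have L0 : L (fun=> 0) = 0.
    have := Llin 1 _ _ (C1_cst ipP 0) (C1_cst ipP 0).
    have -> : (fun _ : X => 1 * 0 + 0 : R) = (fun=> 0) by apply/funext => x; rewrite mul1r addr0.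
    by lra.
  have <- : L (fun x => (-1) * f x + 0) = - L f.
    by rewrite (Llin _ _ _ hf (C1_cst ipP 0)) L0 mulN1r addr0.
  apply: Lbd; first exact: (C1_add ipP (C1_mul ipP (C1_cst ipP _) hf) (C1_cst ipP 0)).
  by move=> x; rewrite addr0 mulN1r normrN.
have Ncut f : C1 f -> N (fun x => f x * cutoff n x) @[n --> \oo] --> N f.
  by move=> hf; apply: cvgN; exact: Lcut.
have [mu1 h1] := pos_part_measure ipP C0 Llin Lbd Lcut sep.
have [mu2 h2] := pos_part_measure ipP C0 Nlin Nbd Ncut sep.
exists mu1, mu2.
have pn f : wC1 f -> (forall x, 0 <= f x <= 1) -> L f = \int[mu1]_x f x - \int[mu2]_x f x.
  move=> wf f01; rewrite h1// h2//.
  have cf := wC1_C1 wf.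
  have f0 x : 0 <= f x by have /andP[] := f01 x.
  have f1 x : f x <= 1 by have /andP[] := f01 x.
  have LB psi : C1 psi -> L (fun x => f x - psi x) = L f - L psi.
    move=> hp; rewrite addrC -mulN1r -Llin//.
    by congr L; apply/funext => x; rewrite mulN1r addrC.
  have fp psi : (forall x, 0 <= psi x <= f x) -> forall x, 0 <= f x - psi x <= f x.
    by move=> hp x; have := hp x; lra.
  (* The map [psi |-> f - psi] preserves the condition [0 <= psi <= f], and
     [L psi = L f + N (f - psi)]. *)
  suff : pos_part ip L f <= L f + pos_part ip N f /\ L f + pos_part ip N f <= pos_part ip L f by lra.
  split.
    apply: (pos_part_le ipP f0) => psi p1 p2.
    have hc : C1 (fun x => f x - psi x) := C1_sub ipP cf p1.
    have := pos_part_ub ipP Nbd f1 hc (fp _ p2).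
    by rewrite /N LB//; lra.
  rewrite -lerBrDl; apply: (pos_part_le ipP f0) => psi p1 p2.
  have hc : C1 (fun x => f x - psi x) := C1_sub ipP cf p1.
  have := pos_part_ub ipP Lbd f1 hc (fp _ p2).
  by rewrite /N LB//; lra.
move=> f wf.
have [M M0 fM] := C1_bounded (wC1_C1 wf).
have M2 : 0 < 2 * M by rewrite mulr_gt0.
(* An affine change sends the range [[-M, M]] into [0, 1]; linearity undoes it. *)
pose f' x := (2 * M)^-1 * f x + 2^-1.
have wf' : wC1 f' := wC1_add ipP (wC1_mul ipP (wC1_cst ipP _) wf) (wC1_cst ipP _).
have f'01 x : 0 <= f' x <= 1.
  have := fM x; rewrite ler_norml /f' => /andP[a b].
  have : - 2^-1 <= (2 * M)^-1 * f x by rewrite mulrC ler_pdivlMr//; lra.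
  have : (2 * M)^-1 * f x <= 2^-1 by rewrite mulrC ler_pdivrMr//; lra.
  lra.
have e1 := pn f' wf' f'01.
have e2 := pn (fun=> 1) (wC1_cst ipP 1) _.
have {}e2 : L (fun=> 1) = \int[mu1]_x 1 - \int[mu2]_x 1.
  by apply: e2 => x; rewrite ler01 lexx.
have fE : f = fun x => (2 * M) * f' x + (- M) * 1.
  by apply/funext => x; rewrite /f'; field; rewrite gt_eqF.
have cM : C1 (fun=> - M * 1) := C1_cst ipP _.
have LM : L (fun=> - M * 1) = - M * L (fun=> 1).
  have L0 : L (fun=> 0) = 0.
    have := Llin 1 _ _ (C1_cst ipP 0) (C1_cst ipP 0).
    have -> : (fun _ : X => 1 * 0 + 0 : R) = (fun=> 0) by apply/funext => x; rewrite mul1r addr0.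
    by lra.
  have := Llin (- M) _ _ (C1_cst ipP 1) (C1_cst ipP 0); by rewrite L0 !addr0 => <-.
have ii (nu : {finite_measure set (hs_XB X) -> \bar R}) : \int[nu]_x f x = 2 * M * \int[nu]_x f' x + (- M) * \int[nu]_x 1.
  have i0 : nu.-integrable setT (EFin \o (f' : hs_XB X -> R)).
    apply: (@bounded_integrable _ _ _ _ 1); first exact: (C1_measurable (wC1_C1 wf')).
    by move=> x; have /andP[a b] := f'01 x; rewrite ger0_norm.
  have i1 (c : R) : nu.-integrable setT (EFin \o ((fun=> c) : hs_XB X -> R)).
    by apply: (@bounded_integrable _ _ _ _ `|c|).
  rewrite fE RintegralD ?RintegralZl//.
  have : nu.-integrable setT (EFin \o (fun x : hs_XB X => 2 * M * f' x)).
    by have := integrableZl measurableT (2 * M) i0.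
  by [].
rewrite [in LHS]fE (Llin _ _ _ (wC1_C1 wf') cM) LM e1 e2 !ii.
ring.
Qed.
End representation.

(** * Quantisation of functions and integrals against differences of finite measures *)

Section measure_facts.
Context (d : measure_display) (T : measurableType d) (R : realType).

Lemma Rintegral_dominated_cvg (mu : {measure set T -> \bar R}) (F : nat -> T -> R)
    (f G : T -> R) : (forall n, measurable_fun setT (F n)) -> measurable_fun setT f ->
  (forall x, F n x @[n --> \oo] --> f x) -> mu.-integrable setT (EFin \o G) ->
  (forall n x, `|F n x| <= G x) ->
  \int[mu]_x F n x @[n --> \oo] --> \int[mu]_x f x.
Proof.
move=> mF mf Ff iG FG.
have fG x : `|f x| <= G x.
  by apply: (cvgr_to_le (cvg_norm (Ff x))); apply: nearW => n; exact: FG.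
have intf : mu.-integrable setT (EFin \o f).
  apply: le_integrable iG => //; first exact/measurable_EFinP.
  by move=> x _ /=; rewrite lee_fin (le_trans (fG x))// ler_norm.
apply: fine_cvg; rewrite fineK; last exact: integrable_fin_num.
apply: (@dominated_cvg _ _ _ mu setT measurableT _ _ (EFin \o G)) => //.
- by move=> n; exact/measurable_EFinP.
- by move=> x _; apply: cvg_EFin; [exact: nearW|exact: Ff].
- by move=> n x _; rewrite /= lee_fin.
Qed.

Lemma finite_bounded_integrable (mu : {finite_measure set T -> \bar R}) (f : T -> R) M :
  measurable_fun setT f -> (forall x, `|f x| <= M) -> mu.-integrable setT (EFin \o f).
Proof.
move=> mf bf; apply: measurable_bounded_integrable => //.
  exact: fin_num_fun_lty.
exists M; split; first exact: num_real.
by move=> y My x _; apply: (le_trans (bf x)); exact: ltW.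
Qed.

(** The code is the index of a bin of width [delta]. Unlike an approximation by a simple function,
    the resulting finite partition can be refined to serve several functions. *)
Lemma level_code (f : T -> R) (M delta : R) : measurable_fun setT f ->
  (forall x, `|f x| <= M) -> 0 < delta -> exists N (c : T -> nat),
  [/\ forall x, (c x < N)%N, forall j, measurable [set x | c x = j] &
      forall x y, c x = c y -> `|f x - f y| <= delta].
Proof.
move=> mf fM d0.
pose h x := (f x + M) / delta.
have fM2 x : 0 <= f x + M <= 2 * M by have := fM x; rewrite ler_norml; lra.
have h0 x : 0 <= h x by have /andP[a _] := fM2 x; rewrite divr_ge0// ltW.
have mh : measurable_fun setT h.
  by apply: measurable_funM => //; apply: measurable_funD.
exists (Num.truncn (2 * M / delta)).+1, (fun x => Num.truncn (h x)); split.
- move=> x; have /andP[h1 _] := truncn_itv (h0 x).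
  have hM : h x <= 2 * M / delta.
    by rewrite ler_wpM2r ?invr_ge0 ?(ltW d0)//; have /andP[] := fM2 x.
  have /andP[_ h2] := truncn_itv (le_trans (h0 x) hM).
  by rewrite -(ltr_nat R) (le_lt_trans h1)// (le_lt_trans hM).
- move=> j.
  have := mh measurableT `[j%:R, j.+1%:R[%classic (measurable_itv _).
  rewrite setTI; congr measurable; apply/seteqP; split => x /=; rewrite in_itv /=.
    by rewrite -truncn_eq// => /eqP.
  by move=> <-; exact: truncn_itv.
- move=> x y e; have := truncn_itv (h0 x); have := truncn_itv (h0 y); rewrite e.
  move: (Num.truncn (h y)) => k; rewrite /h -natr1 !ler_pdivlMr// !ltr_pdivrMr//.
  by move=> /andP[a1 a2] /andP[b1 b2]; rewrite ler_norml; apply/andP; split; lra.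
Qed.

(** Two codes are packed as [c * K + l] with [l < K] and recovered by division with remainder, which
    refines the partitions jointly. *)
Lemma joint_level_code n (f : nat -> T -> R) (M delta : R) :
  (forall i, measurable_fun setT (f i)) -> (forall i, (i < n)%N -> forall x, `|f i x| <= M) ->
  0 < delta -> exists N (c : T -> nat),
  [/\ forall x, (c x < N)%N, forall j, measurable [set x | c x = j] &
      forall x y, c x = c y -> forall i, (i < n)%N -> `|f i x - f i y| <= delta].
Proof.
move=> mf fM d0; elim: n fM => [|n ih] fM.
  exists 1%N, (fun=> 0%N); split => // j.
  have [<-|j0] := eqVneq 0%N j.
    by rewrite (_ : [set _ | _] = setT)//; apply/seteqP; split.
  rewrite (_ : [set _ | _] = set0)//; apply/seteqP; split => x //= e.
  by rewrite e eqxx in j0.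
have [N [c [cN mc cf]]] := ih (fun i hi => fM i (ltnW hi)).
have [K [l [lK ml lf]]] := level_code (mf n) (fM n (ltnSn n)) d0.
have E x : ((c x * K + l x) %/ K = c x /\ (c x * K + l x) %% K = l x)%N.
  by rewrite modnMDl modn_small// divnMDl ?divn_small ?addn0// (leq_ltn_trans _ (lK x)).
exists (N * K)%N, (fun x => c x * K + l x)%N; split.
- move=> x; apply: (@leq_trans ((c x).+1 * K)%N); last by rewrite leq_mul2r cN orbT.
  by rewrite mulSn addnC ltn_add2r.
- move=> j.
  have := measurableI _ _ (mc (j %/ K)%N) (ml (j %% K)%N).
  congr measurable; apply/seteqP; split => x /=.
    by move=> [-> ->]; rewrite -divn_eq.
  by move=> <-; have [-> ->] := E x.
- move=> x y e i; have [c1 l1] := E x; have [c2 l2] := E y.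
  rewrite ltnS leq_eqVlt => /orP[/eqP ->|hi]; last by apply: cf => //; rewrite -c1 -c2 e.
  by apply: lf; rewrite -l1 -l2 e.
Qed.

Lemma Rintegral_step_approx (mu : {finite_measure set T -> \bar R}) (phi : T -> R) M delta
    N (c : T -> nat) (psi : nat -> R) : measurable_fun setT phi ->
  (forall x, `|phi x| <= M) -> (forall x, (c x < N)%N) ->
  (forall j, measurable [set x | c x = j]) ->
  (forall x, `|phi x - psi (c x)| <= delta) ->
  `|\int[mu]_x phi x - \sum_(j < N) psi j * fine (mu [set x | c x = j])|
    <= delta * fine (mu setT).
Proof.
move=> mphi phiM cN mc hd.
pose st n x : R := \sum_(j < n) psi j * \1_[set x | c x = j] x.
have stE x : st N x = psi (c x).
  rewrite /st (bigD1 (Ordinal (cN x)))//= indicE mem_set// mulr1 big1 ?addr0// => j jx.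
  rewrite indicE memNset ?mulr0//= => e; move: jx; apply/negP; rewrite negbK.
  by apply/eqP/val_inj.
have mst n : measurable_fun setT (st n).
  by apply: measurable_sum => j; apply: measurable_funM => //; exact: measurable_indic.
have bst n x : `|st n x| <= \sum_(j < n) `|psi j|.
  apply: (le_trans (ler_norm_sum _ _ _)); apply: ler_sum => j _.
  by rewrite normrM ler_piMr// indicE; case: (_ \in _); rewrite ?normr1 ?normr0.
have ist n : mu.-integrable setT (EFin \o st n) := finite_bounded_integrable mu (mst n) (@bst n).
have Ist n : \int[mu]_x st n x = \sum_(j < n) psi j * fine (mu [set x | c x = j]).
  elim: n => [|n ih].
    rewrite big_ord0 (_ : st 0%N = fun=> 0) ?Rintegral_cst ?mul0r//.
    by apply/funext => x; rewrite /st big_ord0.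
  have E : st n.+1 = fun x => st n x + psi n * \1_[set x | c x = n] x.
    by apply/funext => x; rewrite /st big_ord_recr.
  have b1 x : `|\1_[set x | c x = n] x : R| <= 1.
    by rewrite indicE; case: (_ \in _); rewrite ?normr1 ?normr0.
  have mi : measurable_fun setT (\1_[set x | c x = n] : T -> R) by exact: measurable_indic.
  have i1 := finite_bounded_integrable mu mi b1.
  have i2 : mu.-integrable setT (EFin \o (fun x => psi n * \1_[set x | c x = n] x)).
    apply: (@finite_bounded_integrable _ _ `|psi n|); first exact: measurable_funM.
    by move=> x; rewrite normrM ler_piMr.
  rewrite E big_ord_recr /= -ih (RintegralD measurableT (ist n) i2).
  by rewrite (RintegralZl (psi n) measurableT i1) {2}/Rintegral integral_indic// setIT.
rewrite -Ist -RintegralB//; last exact: finite_bounded_integrable phiM.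
have ib x : `|phi x - st N x| <= delta by rewrite stE.
have mb : measurable_fun setT (fun x => phi x - st N x) by exact: measurable_funB.
have i1 := finite_bounded_integrable mu mb ib.
apply: (le_trans (le_normr_Rintegral measurableT i1)).
rewrite -Rintegral_cst//; apply: le_Rintegral => //.
- apply: (@finite_bounded_integrable _ _ delta) => [|x]; last by rewrite normr_id.
  exact: measurableT_comp.
- by apply: (@finite_bounded_integrable _ _ `|delta|).
Qed.

Definition sint (mu1 mu2 : {finite_measure set T -> \bar R}) (phi : T -> R) : R :=
  \int[mu1]_x phi x - \int[mu2]_x phi x.

Lemma sint_step_approx (mu1 mu2 : {finite_measure set T -> \bar R}) (phi : T -> R) M delta
    N (c : T -> nat) (psi : nat -> R) : measurable_fun setT phi ->
  (forall x, `|phi x| <= M) -> (forall x, (c x < N)%N) ->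
  (forall j, measurable [set x | c x = j]) ->
  (forall x, `|phi x - psi (c x)| <= delta) ->
  `|sint mu1 mu2 phi - \sum_(j < N) psi j *
      (fine (mu1 [set x | c x = j]) - fine (mu2 [set x | c x = j]))|
    <= delta * (fine (mu1 setT) + fine (mu2 setT)).
Proof.
move=> mphi phiM cN mc hd.
have h1 := Rintegral_step_approx mu1 mphi phiM cN mc hd.
have h2 := Rintegral_step_approx mu2 mphi phiM cN mc hd.
under eq_bigr do rewrite mulrBr; rewrite sumrB mulrDr.
apply: le_trans (lerD h1 h2); apply: le_trans (ler_normB _ _).
have E (a1 a2 s1 s2 : R) : a1 - a2 - (s1 - s2) = (a1 - s1) - (a2 - s2) by ring.
by rewrite /sint E.
Qed.

(** A step sum sees only the differences of the measures. This is needed because the definition of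
    BV lets the decomposition of [m_z] depend on the test function. *)
Lemma sint_unique (mu1 mu2 nu1 nu2 : {finite_measure set T -> \bar R}) (phi : T -> R) M :
  (forall B, measurable B -> fine (mu1 B) - fine (mu2 B) = fine (nu1 B) - fine (nu2 B)) ->
  measurable_fun setT phi -> (forall x, `|phi x| <= M) ->
  sint mu1 mu2 phi = sint nu1 nu2 phi.
Proof.
move=> E mphi phiM.
pose K := fine (mu1 setT) + fine (mu2 setT) + (fine (nu1 setT) + fine (nu2 setT)).
have K0 : 0 <= K by rewrite !addr_ge0// fine_ge0.
apply/eqP; rewrite -subr_eq0 -normr_le0; apply/ler_addgt0Pr => e e0; rewrite add0r.
have K1 : 0 < K + 1 by rewrite ltr_wpDl.
have [N [c [cN mc cf]]] := level_code mphi phiM (divr_gt0 e0 K1).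
pose psi j := phi (xget point [set x | c x = j]).
have hd x : `|phi x - psi (c x)| <= e / (K + 1).
  by apply: cf; exact/esym/(@xgetPex _ point [set y | c y = c x] (ex_intro _ x erefl)).
have h1 := sint_step_approx mu1 mu2 mphi phiM cN mc hd.
have h2 := sint_step_approx nu1 nu2 mphi phiM cN mc hd.
have ES : \sum_(j < N) psi j * (fine (mu1 [set x | c x = j]) - fine (mu2 [set x | c x = j]))
    = \sum_(j < N) psi j * (fine (nu1 [set x | c x = j]) - fine (nu2 [set x | c x = j])).
  by apply: eq_bigr => j _; rewrite E.
rewrite -ES in h2; set S := \sum_(j < N) _ in h1 h2.
have -> : sint mu1 mu2 phi - sint nu1 nu2 phi = (sint mu1 mu2 phi - S) - (sint nu1 nu2 phi - S) by ring.
apply: (le_trans (ler_normB _ _)); apply: (le_trans (lerD h1 h2)).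
rewrite -mulrDr -/K mulrAC ler_pdivrMr// ler_wpM2l ?(ltW e0)// lerDl//.
Qed.

Lemma sint_dominated_cvg (mu1 mu2 : {finite_measure set T -> \bar R}) (F : nat -> T -> R)
    (f : T -> R) M : (forall n, measurable_fun setT (F n)) -> measurable_fun setT f ->
  (forall x, F n x @[n --> \oo] --> f x) -> (forall n x, `|F n x| <= M) ->
  sint mu1 mu2 (F n) @[n --> \oo] --> sint mu1 mu2 f.
Proof.
move=> mF mf Ff FM.
have ic (mu : {finite_measure set T -> \bar R}) : mu.-integrable setT (EFin \o (fun=> M)).
  by apply: (@finite_bounded_integrable _ _ `|M|).
by apply: cvgB; apply: (@Rintegral_dominated_cvg _ _ _ (fun=> M)) => //; exact: ic.
Qed.

Lemma sint_indic (mu1 mu2 : {finite_measure set T -> \bar R}) (B : set T) :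
  measurable B -> sint mu1 mu2 \1_B = fine (mu1 B) - fine (mu2 B).
Proof. by move=> mB; rewrite /sint /Rintegral !integral_indic// !setIT. Qed.

(** Young's inequality dominates the product by [|f|^p / p + |g|^q / q]. *)
Lemma integrableM_powR (mu : {measure set T -> \bar R}) (p q : R) (f g : T -> R) :
  0 < p -> 0 < q -> p^-1 + q^-1 = 1 ->
  measurable_fun setT f -> measurable_fun setT g ->
  (\int[mu]_x (`|f x| `^ p)%:E < +oo)%E -> (\int[mu]_x (`|g x| `^ q)%:E < +oo)%E ->
  mu.-integrable setT (EFin \o (fun x => f x * g x)).
Proof.
move=> p0 q0 pq mf mg fp gq.
have ip (r : R) (h : T -> R) : measurable_fun setT h -> (\int[mu]_x (`|h x| `^ r)%:E < +oo)%E ->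
    mu.-integrable setT (EFin \o (fun x => `|h x| `^ r)).
  move=> mh hr; apply/integrableP; split.
    apply/measurable_EFinP.
    have := measurableT_comp (measurable_powR r) (measurableT_comp (@normr_measurable R setT) mh).
    by [].
  by under eq_integral do rewrite /= ger0_norm ?powR_ge0//.
have h1 := integrableZl measurableT p^-1 (ip p f mf fp).
have h2 := integrableZl measurableT q^-1 (ip q g mg gq).
apply: le_integrable (integrableD measurableT h1 h2) => //.
  by apply/measurable_EFinP; exact: measurable_funM.
move=> x _ /=; rewrite lee_fin normrM; apply: le_trans (ler_norm _).
rewrite (mulrC p^-1) (mulrC q^-1).
exact: (conjugate_powR (normr_ge0 (f x)) (normr_ge0 (g x)) p0 q0 pq).
Qed.
End measure_facts.

(** * Pairing [u] with [M^*], and its representation by measures *)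

Section bounded_variation.
Variables (R : realType) (X : completeNormedModType R) (ip : X -> X -> R).
Variables (nu : probability (hs_XB X) R) (Rop : {linear X -> X}).
Variables (v : X -> X -> R) (p : R) (u : X -> R).
Hypothesis ipP : hs_is_inner_product ip.
Hypothesis sep : hs_separable_space X.
Hypothesis Rc : continuous Rop.
Hypothesis SA : hs_standing_assumption ip nu Rop v.
Hypothesis p1 : 1 < p.
Hypothesis uLp : hs_inLp nu p u.

Notation C1 := (C1 ip).
Notation wC1 := (wC1 ip).
Notation C1b := (hs_C1b ip).
Notation V := (hs_Vvar ip nu Rop v u).
Notation XB := (hs_XB X).

Let mv z : measurable_fun [set: XB] (v z : XB -> R).
Proof. by have [/(_ 2)[]] := SA z; rewrite ?ltr1n. Qed.

Let mu_ : measurable_fun [set: XB] (u : XB -> R). Proof. by case: uLp. Qed.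

Let inLp_one q : hs_inLp nu q (fun=> 1).
Proof.
split=> //; under eq_integral do rewrite normr1 powR1.
rewrite integral_cst//= mul1e; exact: fin_num_fun_lty.
Qed.

Lemma integrable_mul_v f q z : 1 < q -> hs_inLp nu q f ->
  nu.-integrable [set: XB] (EFin \o (fun x : XB => f x * v z x)).
Proof.
move=> q1 [mf fq].
have q0 : 0 < q by exact: lt_trans q1.
have q10 : 0 < q - 1 by rewrite subr_gt0.
have r1 : 1 < q / (q - 1) by rewrite ltr_pdivlMr//; lra.
have [/(_ _ r1)[mvz vq] _] := SA z.
apply: (integrableM_powR q0 _ _ mf mvz fq vq); first by rewrite divr_gt0.
by field; rewrite !gt_eqF.
Qed.

Lemma integrable_Lp f q : 1 < q -> hs_inLp nu q f ->
  nu.-integrable [set: XB] (EFin \o (f : XB -> R)).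
Proof.
move=> q1 [mf fq].
have q0 : 0 < q by exact: lt_trans q1.
have q10 : 0 < q - 1 by rewrite subr_gt0.
have r1 : 0 < q / (q - 1) by rewrite divr_gt0.
have [m1 l1] := inLp_one (q / (q - 1)).
have := integrableM_powR q0 r1 _ mf m1 fq l1.
have -> : (fun x : XB => f x * 1) = f by apply/funext => x; rewrite mulr1.
by apply; field; rewrite !gt_eqF.
Qed.

Lemma integrable_v z : nu.-integrable [set: XB] (EFin \o (v z : XB -> R)).
Proof.
have q2 : 1 < 2 :> R by rewrite ltr1n.
by have [h _] := SA z; exact: (integrable_Lp q2 (h 2 q2)).
Qed.

(* The integrand of [M^*] for the field [phi z], and its integral against [u]. *)
Definition dint z (phi : X -> R) (g : X -> X) (x : X) : R :=
  u x * (- ip (Rop (g x)) z + v z x * phi x).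

Definition dual z phi g : R := \int[nu]_x (dint z phi g x : R).

Lemma Rop_bounded : exists2 K, 0 < K & forall x, `|Rop x| <= K * `|x|.
Proof. exact: linear_lipschitz. Qed.

Lemma ip_Rop_measurable z phi g : C1b phi g ->
  measurable_fun [set: XB] (fun x : XB => ip (Rop (g x)) z).
Proof.
move=> [_ [_ [gc _]]]; apply: continuous_measurable => x.
apply: (@continuous_comp _ _ _ (fun x => Rop (g x)) (ip ^~ z)); last exact: ip_continuousl.
by apply: continuous_comp; [exact: gc|exact: Rc].
Qed.

Lemma ip_Rop_bound z g N K : (forall x, `|Rop x| <= K * `|x|) -> 0 < K ->
  (forall x, `|g x| <= N) -> forall x : X, `|ip (Rop (g x)) z| <= K * N * `|z|.
Proof.
move=> hK K0 gN x; apply: (le_trans (ip_CS ipP _ _)); rewrite ler_wpM2r//.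
by apply: (le_trans (hK _)); rewrite ler_wpM2l// ltW.
Qed.

Lemma dint_measurable z phi g : C1b phi g -> measurable_fun [set: XB] (dint z phi g : XB -> R).
Proof.
move=> h; apply: measurable_funM => //; apply: measurable_funD.
  by apply: measurableT_comp => //; exact: ip_Rop_measurable h.
by apply: measurable_funM => //; apply: (C1_measurable (ip := ip)); exists g.
Qed.

Lemma dint_bound z phi g M N K : (forall x, `|Rop x| <= K * `|x|) -> 0 < K ->
  (forall x, `|phi x| <= M) -> (forall x, `|g x| <= N) ->
  forall x, `|dint z phi g x| <= K * N * `|z| * `|u x| + M * `|u x * v z x|.
Proof.
move=> hK K0 fM gN x; rewrite /dint mulrDr (le_trans (ler_normD _ _))// lerD//.
  by rewrite normrM normrN mulrC ler_wpM2r// (ip_Rop_bound z hK).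
by rewrite mulrA normrM mulrC ler_wpM2r.
Qed.

Lemma dominating_integrable a b z :
  nu.-integrable [set: XB] (EFin \o (fun x : XB => a * `|u x| + b * `|u x * v z x|)).
Proof.
have h1 := integrableZl measurableT a (integrable_abse (integrable_Lp p1 uLp)).
have h2 := integrableZl measurableT b (integrable_abse (integrable_mul_v z p1 uLp)).
exact: (integrableD measurableT h1 h2).
Qed.

Lemma dint_integrable z phi g : C1b phi g ->
  nu.-integrable [set: XB] (EFin \o (dint z phi g : XB -> R)).
Proof.
move=> h; have [K K0 hK] := Rop_bounded.
have [[M fM] [_ [_ [N gN]]]] := h.
apply: le_integrable (dominating_integrable (K * N * `|z|) M z) => //.
  by apply/measurable_EFinP; exact: dint_measurable.
move=> x _ /=; rewrite lee_fin; apply: le_trans (ler_norm _).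
exact: dint_bound.
Qed.

(** Bounded pointwise convergence of functions together with their gradients is the mode of
    approximation used both for cutoffs and for projections. *)
Lemma dual_cvg z (F : nat -> X -> R) (G : nat -> X -> X) phi g M N :
  (forall n, C1b (F n) (G n)) -> C1b phi g ->
  (forall n x, `|F n x| <= M) -> (forall n x, `|G n x| <= N) ->
  (forall x, F n x @[n --> \oo] --> phi x) -> (forall x, G n x @[n --> \oo] --> g x) ->
  dual z (F n) (G n) @[n --> \oo] --> dual z phi g.
Proof.
move=> hF h FM GN Fc Gc; have [K K0 hK] := Rop_bounded.
apply: (@Rintegral_dominated_cvg _ _ _ _ _ _ (fun x : XB => K * N * `|z| * `|u x| + M * `|u x * v z x|)).
- by move=> n; exact: dint_measurable.
- exact: dint_measurable.
- move=> x; apply: cvgMr; apply: cvgD; last by apply: cvgMr; exact: Fc.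
  apply: cvgN; apply: ip_cvgl => //.
  have c : {for g x, continuous Rop} by exact: Rc.
  by apply: (continuous_cvg _ c); exact: Gc.
- exact: dominating_integrable.
- by move=> n x; exact: dint_bound.
Qed.

Lemma dual_linear z a f1 g1 f2 g2 : C1b f1 g1 -> C1b f2 g2 ->
  dual z (fun x => a * f1 x + f2 x) (fun x => a *: g1 x + g2 x) = a * dual z f1 g1 + dual z f2 g2.
Proof.
move=> h1 h2; have i1 := dint_integrable z h1; have i2 := dint_integrable z h2.
rewrite /dual -(RintegralZl a measurableT i1) -RintegralD//; last exact: (integrableZl measurableT a i1).
apply: eq_Rintegral => x _; rewrite /dint linearP (ip_linl ipP); ring.
Qed.

Lemma dualZ z a f g : C1b f g -> dual z (fun x => a * f x) (fun x => a *: g x) = a * dual z f g.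
Proof.
move=> h; rewrite /dual -(RintegralZl a measurableT (dint_integrable z h)).
apply: eq_Rintegral => x _; rewrite /dint linearZ /= (ipZl ipP); ring.
Qed.

Lemma integral_Mstar n (f : 'I_n -> X -> R) (g : 'I_n -> X -> X) (z : 'I_n -> X) :
  (forall i, C1b (f i) (g i)) ->
  (\int[nu]_x (u x * hs_Mstar ip Rop v f g z x)%:E)%E = (\sum_(i < n) dual (z i) (f i) (g i))%:E.
Proof.
move=> h.
have E x : u x * hs_Mstar ip Rop v f g z x = \sum_(i < n) dint (z i) (f i) (g i) x.
  by rewrite /hs_Mstar mulr_sumr.
under eq_integral do rewrite E -sumEFin.
rewrite integral_sum//; last by move=> i; exact: dint_integrable.
rewrite -sumEFin; apply: eq_bigr => i _; rewrite /dual /Rintegral fineK//.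
by apply: integrable_fin_num => //; exact: dint_integrable.
Qed.

Lemma Vvar_ub n (f : 'I_n -> X -> R) (g : 'I_n -> X -> X) (z : 'I_n -> X) :
  (forall i, C1b (f i) (g i)) -> (forall x, `|\sum_(i < n) f i x *: z i| <= 1) ->
  ((\sum_(i < n) dual (z i) (f i) (g i))%:E <= V)%E.
Proof.
move=> h h1; apply: ereal_sup_ubound; exists n, f, g, z; split => //; split => //.
by rewrite integral_Mstar.
Qed.

Lemma Vvar_le (r : \bar R) :
  (forall n (f : 'I_n -> X -> R) (g : 'I_n -> X -> X) (z : 'I_n -> X),
    (forall i, C1b (f i) (g i)) -> (forall x, `|\sum_(i < n) f i x *: z i| <= 1) ->
    ((\sum_(i < n) dual (z i) (f i) (g i))%:E <= r)%E) -> (V <= r)%E.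
Proof.
move=> h; apply: ge_ereal_sup => _ [n [f [g [z [hf [h1 ->]]]]]].
by rewrite integral_Mstar//; exact: h.
Qed.

Lemma Vvar_ge0 : (0 <= V)%E.
Proof.
have h : ((\sum_(i < 0) dual 0 (fun=> 0) (fun=> 0))%:E <= V)%E.
  apply: (@Vvar_ub 0 (fun _ _ => 0) (fun _ _ => 0) (fun=> 0)) => [[]//|x].
  by rewrite big_ord0 normr0.
by rewrite big_ord0 in h.
Qed.

Lemma limit_closed_integral_eq0 (W : X -> R) : nu.-integrable [set: XB] (EFin \o (W : XB -> R)) ->
  limit_closed (fun h : X -> R => measurable_fun [set: XB] (h : XB -> R) /\
    \int[nu]_x (W x * h x) = 0).
Proof.
move=> iW F f FQ F01 Ff.
have mW : measurable_fun [set: XB] (W : XB -> R) by have /integrableP[/measurable_EFinP] := iW.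
have mf : measurable_fun [set: XB] (f : XB -> R).
  by apply: (@measurable_fun_cvg _ XB R setT F f) => [n|x _]; [have [] := FQ n|exact: Ff].
split=> //.
have h : \int[nu]_x (W x * F n x) @[n --> \oo] --> \int[nu]_x (W x * f x).
  apply: (@Rintegral_dominated_cvg _ _ _ _ _ _ (fun x : XB => `|W x|)).
  - by move=> n; apply: measurable_funM => //; have [] := FQ n.
  - exact: measurable_funM.
  - by move=> x; apply: cvgMr; exact: Ff.
  - exact: (integrable_abse iW).
  - move=> n x; have /andP[a b] := F01 n x.
    by rewrite normrM (ger0_norm a) ler_piMr.
have h0 : \int[nu]_x (W x * F n x) @[n --> \oo] --> (0 : R).
  by apply: cvg_near_cst; apply: nearW => n; have [] := FQ n.
exact: (cvg_unique (@Rhausdorff R) h h0).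
Qed.

Lemma ae_eq0_of_integral_wC1 (W : X -> R) : nu.-integrable [set: XB] (EFin \o (W : XB -> R)) ->
  (forall h, wC1 h -> (forall x, 0 <= h x <= 1) -> \int[nu]_x (W x * h x) = 0) ->
  ae_eq nu [set: XB] (EFin \o (W : XB -> R)) (cst 0%E).
Proof.
move=> iW h0.
have mW : measurable_fun [set: XB] (W : XB -> R) by have /integrableP[/measurable_EFinP] := iW.
apply: integral_ae_eq => // E _ mE.
have base h : wC1 h -> (forall x, 0 <= h x <= 1) ->
    measurable_fun [set: XB] (h : XB -> R) /\ \int[nu]_x (W x * h x) = 0.
  by move=> wh h01; split; [exact: (C1_measurable (wC1_C1 wh))|exact: h0].
have [m1 e1] := monotone_class ipP sep base (limit_closed_integral_eq0 iW) mE.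
rewrite integral_cst ?mul0e// integral_mkcond.
have -> : ((EFin \o (W : XB -> R)) \_ E) = (EFin \o (fun x : XB => W x * \1_E x)).
  apply/funext => x; rewrite patchE /= indicE; case: (x \in E); rewrite ?mulr1 ?mulr0//.
have i1 : nu.-integrable [set: XB] (EFin \o (fun x : XB => W x * \1_E x)).
  apply: le_integrable iW => //; first by apply/measurable_EFinP; exact: measurable_funM.
  by move=> x _ /=; rewrite lee_fin normrM ler_piMr// indicE; case: (_ \in _); rewrite ?normr1 ?normr0.
by rewrite -[LHS]fineK; [congr EFin; exact: e1|exact: integrable_fin_num].
Qed.

Lemma standing_Rintegral z phi g : C1b phi g ->
  \int[nu]_x (v z x * phi x) = \int[nu]_x ip (Rop (g x)) z.
Proof. by move=> h; have [_ /(_ _ _ h)] := SA z => e; rewrite /Rintegral e. Qed.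

(** Integration by parts gives both sides the same integral against every test function, and these
    integrals determine an integrable function almost everywhere. *)
Lemma v_linear_ae a z w : ae_eq nu [set: XB]
  (EFin \o (fun x : XB => v (a *: z + w) x - (a * v z x + v w x))) (cst 0%E).
Proof.
have iW : nu.-integrable [set: XB] (EFin \o (fun x : XB => v (a *: z + w) x - (a * v z x + v w x))).
  exact: (integrableB measurableT (integrable_v (a *: z + w))
    (integrableD measurableT (integrableZl measurableT a (integrable_v z)) (integrable_v w))).
apply: ae_eq0_of_integral_wC1 iW _ => h [[g hg] _] h01.
have iv y : nu.-integrable [set: XB] (EFin \o (fun x : XB => v y x * h x)).
  apply: le_integrable (integrable_v y) => //.
    apply/measurable_EFinP; apply: measurable_funM => //.
    by apply: (C1_measurable (ip := ip)); exists g.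
  move=> x _ /=; have /andP[b0 b1] := h01 x.
  by rewrite lee_fin normrM (ger0_norm b0) ler_piMr.
have [K K0 hK] := Rop_bounded; have [_ [_ [_ [N gN]]]] := hg.
have ii y : nu.-integrable [set: XB] (EFin \o (fun x : XB => ip (Rop (g x)) y)).
  apply: (finite_bounded_integrable _ (ip_Rop_measurable y hg)).
  exact: (ip_Rop_bound y hK K0 gN).
have E : \int[nu]_x ((v (a *: z + w) x - (a * v z x + v w x)) * h x)
   = \int[nu]_x (v (a *: z + w) x * h x) - (a * \int[nu]_x (v z x * h x) + \int[nu]_x (v w x * h x)).
  rewrite -(RintegralZl a measurableT (iv z)).
  have ia := integrableZl measurableT a (iv z).
  rewrite -(RintegralD measurableT ia (iv w)).
  rewrite -(RintegralB measurableT (iv _) (integrableD measurableT ia (iv w))).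
  by apply: eq_Rintegral => x _; ring.
rewrite E !(standing_Rintegral _ hg).
have -> : \int[nu]_x ip (Rop (g x)) (a *: z + w)
    = a * \int[nu]_x ip (Rop (g x)) z + \int[nu]_x ip (Rop (g x)) w.
  rewrite -(RintegralZl a measurableT (ii z)) -(RintegralD measurableT (integrableZl measurableT a (ii z)) (ii w)).
  by apply: eq_Rintegral => x _; rewrite (ipDr ipP) (ipZr ipP).
by rewrite subrr.
Qed.

Lemma dual_linear_direction a z w phi g : C1b phi g ->
  dual (a *: z + w) phi g = a * dual z phi g + dual w phi g.
Proof.
move=> h; have i1 := dint_integrable z h; have i2 := dint_integrable w h.
have i0 := dint_integrable (a *: z + w) h.
have ia := integrableZl measurableT a i1.
rewrite /dual -(RintegralZl a measurableT i1) -(RintegralD measurableT ia i2).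
congr fine; apply: ae_eq_integral => //.
- exact: measurable_int i0.
- exact: (measurable_int _ (integrableD measurableT ia i2)).
- have := v_linear_ae a z w; apply: filterS => x /= e _.
  have := e I => -[e0]; congr EFin; rewrite /dint (ipDr ipP) (ipZr ipP).
  have -> : v (a *: z + w) x = a * v z x + v w x by apply/eqP; rewrite -subr_eq0 e0.
  ring.
Qed.

(** Makes [dual z] a functional of [phi] alone, the form required by Daniell's construction. *)
Definition gradient (phi : X -> R) : X -> X := xget (fun=> 0) [set g | C1b phi g].

Lemma gradientE phi g : C1b phi g -> gradient phi = g.
Proof.
move=> h; apply: (C1b_grad_unique ipP (f := phi)) => //.
exact: (@xgetPex _ _ [set g | C1b phi g] (ex_intro _ g h)).
Qed.

Lemma dual_representation z : (V < +oo)%E ->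
  exists mu1 mu2 : {finite_measure set XB -> \bar R},
    forall phi g, C1b phi g -> dual z phi g = sint mu1 mu2 phi.
Proof.
move=> Vfin.
have Vf : V \is a fin_num by rewrite ge0_fin_numE// Vvar_ge0.
pose Vr := fine V.
have Vr0 : 0 <= Vr by rewrite fine_ge0// Vvar_ge0.
pose L phi := dual z phi (gradient phi).
have LE phi g : C1b phi g -> L phi = dual z phi g by move=> h; rewrite /L (gradientE h).
have C1bL a f1 g1 f2 g2 : C1b f1 g1 -> C1b f2 g2 ->
    C1b (fun x => a * f1 x + f2 x) (fun x => a *: g1 x + g2 x).
  move=> h1 h2; have := C1b_add ipP (C1b_mul ipP (C1b_cst ipP a) h1) h2.
  by congr hs_C1b; apply/funext => x; rewrite scaler0 addr0.
have Llin a f g : C1 f -> C1 g -> L (fun x => a * f x + g x) = a * L f + L g.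
  move=> [g1 h1] [g2 h2].
  by rewrite (LE _ _ h1) (LE _ _ h2) (LE _ _ (C1bL a _ _ _ _ h1 h2)) dual_linear.
have Lbd f M : C1 f -> (forall x, `|f x| <= M) -> L f <= Vr * (`|z| + 1) * M.
  move=> [g h] fM; rewrite (LE _ _ h).
  have M0 : 0 <= M by apply: le_trans (fM 0).
  have z1 : 0 < `|z| + 1 by rewrite ltr_wpDl.
  have [M00|Mn0] := eqVneq M 0.
    have fE x : f x = 0 by apply/eqP; rewrite -normr_le0 -M00.
    have gE : g = fun=> 0.
      apply: (C1b_grad_unique ipP (f := f) h); have := C1b_cst ipP 0.
      by congr hs_C1b; apply/funext => x; rewrite fE.
    have d0 : forall x : XB, x \in [set: XB] -> dint z f g x = cst 0 x.
      by move=> x _; rewrite /dint gE fE linear0 (ip0l ipP) oppr0 mulr0 addr0 mulr0.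
    by rewrite /dual (eq_Rintegral _ d0) Rintegral_cst// mul0r M00 mulr0.
  have Mp : 0 < M by rewrite lt_def Mn0.
  (* With this factor the field [t f z] has norm at most 1; the summand 1 avoids a division by zero
     when [z = 0]. *)
  pose t := (M * (`|z| + 1))^-1.
  have t0 : 0 < t by rewrite invr_gt0 mulr_gt0.
  have ht : C1b (fun x => t * f x) (fun x => t *: g x).
    have := C1b_mul ipP (C1b_cst ipP t) h.
    by congr hs_C1b; apply/funext => x; rewrite scaler0 addr0.
  have : ((\sum_(i < 1) dual z (fun x => t * f x) (fun x => t *: g x))%:E <= V)%E.
    apply: (@Vvar_ub 1 (fun _ x => t * f x) (fun _ x => t *: g x) (fun=> z)) => // x.
    rewrite big_ord1 normrZ normrM (gtr0_norm t0) /t -mulrA mulrC ler_pdivrMr ?mulr_gt0// mul1r.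
    by rewrite ler_pM// lerDl.
  rewrite big_ord1 dualZ// -(fineK Vf) lee_fin -/Vr => h1.
  have : dual z f g = t^-1 * (t * dual z f g) by rewrite mulrA mulVf ?mul1r// gt_eqF.
  move=> ->; rewrite /t invrK -/t (_ : Vr * (`|z| + 1) * M = M * (`|z| + 1) * Vr); last by ring.
  by rewrite ler_wpM2l// mulr_ge0// ltW.
have Lcut f : C1 f -> L (fun x => f x * cutoff n x) @[n --> \oo] --> L f.
  move=> [g h]; rewrite (LE _ _ h).
  have hc n := C1b_mul ipP h (C1b_cutoff ipP n).
  rewrite (_ : (fun n => L (fun x => f x * cutoff n x)) =
     fun n => dual z (fun x => f x * cutoff n x) (fun x => f x *: dcutoff n x + cutoff n x *: g x)); last first.
    by apply/funext => n; exact: (LE _ _ (hc n)).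
  have [[M fM] [_ [_ [N gN]]]] := h.
  have ev (x : X) : \forall n \near \oo, cutoff n x = 1 /\ dcutoff n x = 0.
    exists (Num.truncn (`|x| ^+ 2)) => // k /= hk; apply: cutoff_in.
    have /andP[_ h1] := truncn_itv (sqr_ge0 `|x| : 0 <= `|x| ^+ 2).
    by apply: (le_trans (ltW h1)); rewrite ler_nat.
  apply: (@dual_cvg _ _ _ _ _ M (M * 24 + N)) => //.
  - move=> n x; rewrite normrM (ger0_norm (cutoff_ge0 _ _)).
    by apply: le_trans (fM x); rewrite ler_piMr// cutoff_le1.
  - move=> n x; apply: (le_trans (ler_normD _ _)); rewrite (normrZ (f x)) (normrZ (cutoff n x)) lerD//.
      by rewrite ler_pM// dcutoff_bound.
    rewrite (ger0_norm (cutoff_ge0 _ _)); apply: le_trans (gN x).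
    by rewrite ler_piMl// cutoff_le1.
  - move=> x; apply: cvg_near_cst; apply: filterS (ev x) => n [-> _].
    by rewrite mulr1.
  - move=> x; apply: cvg_near_cst; apply: filterS (ev x) => n [-> ->].
    by rewrite scaler0 add0r scale1r.
have C0 : 0 <= Vr * (`|z| + 1) by rewrite mulr_ge0// addr_ge0.
have [mu1 [mu2 hmu]] := functional_representation ipP sep C0 Llin Lbd Lcut.
exists mu1, mu2 => phi g h.
have [a a_dense] := dense_sequence sep.
have Pc := gs_proj_cvg ipP a_dense.
have hP n := C1b_gs_proj ipP a n h.
have [[M fM] [_ [gc [N gN]]]] := h.
have phic := C1b_continuous h.
have cv1 : dual z (phi \o gs_proj ip a n) (fun x => gs_proj ip a n (g (gs_proj ip a n x))) @[n --> \oo]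
    --> dual z phi g.
  apply: (@dual_cvg _ _ _ _ _ M N) => //.
  - by move=> n x; exact: fM.
  - by move=> n x; apply: le_trans (gN (gs_proj ip a n x)); exact: gs_proj_contract.
  - move=> x; have c : {for x, continuous phi} by exact: phic.
    by apply: (continuous_cvg _ c); exact: Pc.
  - move=> x; apply/cvgrPdist_lt => e e0.
    have e2 : 0 < e / 2 by rewrite divr_gt0.
    have c : {for x, continuous g} by exact: gc.
    have c1 : g (gs_proj ip a n x) @[n --> \oo] --> g x by apply: (continuous_cvg _ c); exact: Pc.
    have /cvgrPdist_lt /(_ _ e2) n1 := Pc (g x).
    have /cvgrPdist_lt /(_ _ e2) n2 := c1.
    near=> n.
    (* With [P] the projection, [g x - P (g (P x)) = (g x - P (g x)) + P (g x - g (P x))], and [P]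
       is a contraction. *)
    rewrite -(subrK (gs_proj ip a n (g x)) (g x)) -addrA.
    rewrite (le_lt_trans (ler_normD _ _))// [e]splitr ltrD//.
      by near: n; exact: n1.
    rewrite -(gs_projB ipP); apply: (le_lt_trans (gs_proj_contract ipP _ _ _)).
    by near: n; exact: n2.
have cv2 : sint mu1 mu2 (phi \o gs_proj ip a n) @[n --> \oo] --> sint mu1 mu2 phi.
  apply: (@sint_dominated_cvg _ _ _ _ _ _ _ M).
  - by move=> n; apply: (C1_measurable (ip := ip)); eexists; exact: hP.
  - by apply: (C1_measurable (ip := ip)); exists g.
  - move=> x; have c : {for x, continuous phi} by exact: phic.
    by apply: (continuous_cvg _ c); exact: Pc.
  - by move=> n x; exact: fM.
have E n : dual z (phi \o gs_proj ip a n) (fun x => gs_proj ip a n (g (gs_proj ip a n x)))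
    = sint mu1 mu2 (phi \o gs_proj ip a n).
  rewrite -(LE _ _ (hP n)); apply: hmu; apply: wC1_gs_proj => //; by exists g.
rewrite (_ : (fun n => dual _ _ _) = (fun n => sint mu1 mu2 (phi \o gs_proj ip a n))) in cv1.
  exact: (cvg_unique (@Rhausdorff R) cv1 cv2).
by apply/funext => n; exact: E.
Unshelve. all: by end_near. Qed.
End bounded_variation.

(** * Variation over disjoint Borel sets is bounded by [V] *)

Section total_variation.
Variables (R : realType) (X : completeNormedModType R) (ip : X -> X -> R).
Variables (nu : probability (hs_XB X) R) (Rop : {linear X -> X}).
Variables (v : X -> X -> R) (p : R) (u : X -> R).
Hypothesis ipP : hs_is_inner_product ip.
Hypothesis sep : hs_separable_space X.
Hypothesis Rc : continuous Rop.
Hypothesis SA : hs_standing_assumption ip nu Rop v.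
Hypothesis p1 : 1 < p.
Hypothesis uLp : hs_inLp nu p u.

Notation C1 := (C1 ip).
Notation wC1 := (wC1 ip).
Notation C1b := (hs_C1b ip).
Notation V := (hs_Vvar ip nu Rop v u).
Notation XB := (hs_XB X).
Notation dual := (dual ip nu Rop v u).

(* [left_over f i] times [f i] turns functions with values in [0, 1] into a
   sub-partition of unity. *)
Fixpoint left_over (f : nat -> X -> R) i x : R :=
  if i is k.+1 then left_over f k x * (1 - f k x) else 1.

Definition weight (f : nat -> X -> R) i x : R := f i x * left_over f i x.

Lemma left_over01 f i x : (forall k, 0 <= f k x <= 1) -> 0 <= left_over f i x <= 1.
Proof.
move=> f01; elim: i => [|i /andP[a b]] /=; first by rewrite ler01 lexx.
have /andP[c d] := f01 i.
by rewrite mulr_ge0 ?subr_ge0//= mulr_ile1// ?subr_ge0// lerBlDr lerDl.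
Qed.

Lemma weight01 f i x : (forall k, 0 <= f k x <= 1) -> 0 <= weight f i x <= 1.
Proof.
move=> f01; have /andP[a b] := left_over01 i f01; have /andP[c d] := f01 i.
by rewrite mulr_ge0//= mulr_ile1.
Qed.

Lemma sum_weight f n x : \sum_(i < n) weight f i x = 1 - left_over f n x.
Proof.
elim: n => [|n ih]; first by rewrite big_ord0 subrr.
by rewrite big_ord_recr /= ih /weight; ring.
Qed.

Lemma weight_measurable f i : (forall k, measurable_fun [set: XB] (f k : XB -> R)) ->
  measurable_fun [set: XB] (weight f i : XB -> R).
Proof.
move=> mf; apply: measurable_funM => //.
elim: i => [|i ih] //=.
by apply: measurable_funM => //; exact: measurable_funB.
Qed.

Lemma weight_cvg (F : nat -> nat -> X -> R) (f : nat -> X -> R) i x :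
  (forall k, F n k x @[n --> \oo] --> f k x) -> weight (F n) i x @[n --> \oo] --> weight f i x.
Proof.
move=> Ff; apply: cvgM; first exact: Ff.
elim: i => [|i ih] /=; first exact: cvg_cst.
by apply: cvgM => //; apply: cvgB; [exact: cvg_cst|exact: Ff].
Qed.

Lemma weight_C1 f i : (forall k, wC1 (f k)) -> wC1 (weight f i).
Proof.
move=> wf; apply: (wC1_mul ipP (wf i)).
elim: i => [|i ih] /=; first exact: wC1_cst.
exact: (wC1_mul ipP ih (wC1_sub ipP (wC1_cst ipP 1) (wf i))).
Qed.

(** The pairs for different [z] are unrelated; only the differences [mu1 z - mu2 z] turn out to
    depend linearly on [z]. *)
Definition represents (mu1 mu2 : X -> {finite_measure set XB -> \bar R}) :=
  forall z phi g, C1b phi g -> dual z phi g = sint (mu1 z) (mu2 z) phi.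

Lemma sum_weight_le_Vvar (mu1 mu2 : X -> {finite_measure set XB -> \bar R}) N (z : nat -> X)
    (f : nat -> X -> R) (r : R) : V = r%:E -> represents mu1 mu2 ->
  (forall i, `|z i| <= 1) -> (forall k, wC1 (f k)) -> (forall k x, 0 <= f k x <= 1) ->
  \sum_(i < N) sint (mu1 (z i)) (mu2 (z i)) (weight f i) <= r.
Proof.
move=> Vr rep z1 wf f01.
have /choice[g hg] : forall i, exists g, C1b (weight f i) g.
  by move=> i; have [] := weight_C1 i wf.
have := @Vvar_ub _ _ _ nu Rop v p u ipP Rc SA p1 uLp N (fun i => weight f i) (fun i => g i) (fun i => z i).
rewrite Vr lee_fin => h; apply: le_trans (h (fun i => hg i) _).
  by apply: ler_sum => i _; rewrite (rep _ _ _ (hg i)).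
move=> x; apply: (le_trans (ler_norm_sum _ _ _)).
apply: (@le_trans _ _ (\sum_(i < N) weight f i x)).
  apply: ler_sum => i _; have /andP[a b] := weight01 i (f01^~ x).
  by rewrite normrZ (ger0_norm a) ler_piMr.
rewrite sum_weight lerBlDr lerDl.
by have /andP[] := left_over01 N (f01^~ x).
Qed.

Let upd (f : nat -> X -> R) j h k := if k == j then h else f k.

(* The indicator functions of the [B k] are reached one coordinate at a time,
   each time by the monotone class theorem. *)
Lemma sum_variation_le_Vvar (mu1 mu2 : X -> {finite_measure set XB -> \bar R}) N (z : nat -> X)
    (B : nat -> set XB) (r : R) : V = r%:E -> represents mu1 mu2 ->
  (forall i, `|z i| <= 1) -> (forall k, measurable (B k)) -> trivIset setT B ->
  \sum_(i < N) (fine (mu1 (z i) (B i)) - fine (mu2 (z i) (B i))) <= r.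
Proof.
move=> Vr rep z1 mB tB.
pose S (f : nat -> X -> R) := \sum_(i < N) sint (mu1 (z i)) (mu2 (z i)) (weight f i) <= r.
pose ok (f : nat -> X -> R) := forall k, measurable_fun [set: XB] (f k : XB -> R) /\
  forall x, 0 <= f k x <= 1.
have wok h : wC1 h -> (forall x, 0 <= h x <= 1) ->
  measurable_fun [set: XB] (h : XB -> R) /\ forall x, 0 <= h x <= 1.
  by move=> wh h01; split => //; exact: (C1_measurable (wC1_C1 wh)).
have iok (A : set XB) : measurable A -> measurable_fun [set: XB] (\1_A : XB -> R) /\
    forall x : X, 0 <= (\1_A x : R) <= 1.
  move=> mA; split; first exact: measurable_indic.
  by move=> x; rewrite indicE; case: (_ \in _); rewrite ?lexx ?ler01.
have step j : forall f : nat -> X -> R, (forall k, (k < j)%N -> f k = \1_(B k)) ->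
    (forall k, (j <= k)%N -> wC1 (f k) /\ forall x, 0 <= f k x <= 1) -> S f.
  elim: j => [|j ih] f fB fA.
    by apply: (sum_weight_le_Vvar N Vr rep z1) => k; have [] := fA k isT.
  have fok k : k != j -> measurable_fun [set: XB] (f k : XB -> R) /\ forall x, 0 <= f k x <= 1.
    move=> kj; have [kl|kl] := ltnP k j.
      by rewrite (fB k (leqW kl)); exact: iok (mB k).
    have [] := fA k; first by rewrite ltn_neqAle eq_sym kj.
    exact: wok.
  have uok h : (measurable_fun [set: XB] (h : XB -> R) /\ forall x, 0 <= h x <= 1) -> ok (upd f j h).
    by move=> hh k; rewrite /upd; case: eqVneq => // kj; exact: fok.
  (* Measurability and range are carried along because dominated convergence of the weights uses
     both. *)
  pose Q (h : X -> R) := (measurable_fun [set: XB] (h : XB -> R) /\ forall x, 0 <= h x <= 1) /\ S (upd f j h).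
  have Q0 h : wC1 h -> (forall x, 0 <= h x <= 1) -> Q h.
    move=> wh h01; split; first exact: wok.
    apply: ih => k kj; rewrite /upd.
      by rewrite (ltn_eqF kj) fB// ltnW.
    case: eqVneq => // kj'; apply: fA.
    by rewrite ltn_neqAle eq_sym kj'.
  have Ql : limit_closed Q.
    move=> F h FQ F01 Fh.
    have hok : measurable_fun [set: XB] (h : XB -> R) /\ forall x, 0 <= h x <= 1.
      split.
        by apply: (@measurable_fun_cvg _ XB R setT F h) => [n|x _]; [have [[]] := FQ n|exact: Fh].
      move=> x; apply/andP; split.
        by apply: (cvgr_to_ge (Fh x)); apply: nearW => n; have /andP[] := F01 n x.
      by apply: (cvgr_to_le (Fh x)); apply: nearW => n; have /andP[] := F01 n x.
    split => //.
    have FOK n : ok (upd f j (F n)) by apply: uok; have [] := FQ n.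
    have HOK := uok _ hok.
    have cv : \sum_(i < N) sint (mu1 (z i)) (mu2 (z i)) (weight (upd f j (F n)) i) @[n --> \oo]
        --> \sum_(i < N) sint (mu1 (z i)) (mu2 (z i)) (weight (upd f j h) i).
      apply: cvg_big => [|i _]; first exact: add_continuous.
      apply: (@sint_dominated_cvg _ _ _ _ _ _ _ 1).
      - by move=> n; apply: weight_measurable => k; have [] := FOK n k.
      - by apply: weight_measurable => k; have [] := HOK k.
      - move=> x; apply: weight_cvg => k; rewrite /upd; case: eqVneq => _; first exact: Fh.
        exact: cvg_cst.
      - move=> n x; have /andP[a b] := @weight01 (upd f j (F n)) i x (fun k => (FOK n k).2 x).
        by rewrite ger0_norm.
    by apply: (cvgr_to_le cv); apply: nearW => n; have [_] := FQ n.
  have [_] := monotone_class ipP sep Q0 Ql (mB j).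
  congr S; apply/funext => k; rewrite /upd; case: eqVneq => // ->.
  by rewrite fB.
pose f k : X -> R := if (k < N)%N then \1_(B k) else fun=> 0.
have Sf : S f.
  apply: (step N) => k kN; rewrite /f; first by rewrite kN.
  rewrite ltnNge kN /=; split; first exact: wC1_cst.
  by move=> x; rewrite lexx ler01.
apply: le_trans Sf; apply: ler_sum => i _.
(* On [B i] all earlier indicator functions vanish by disjointness, so [left_over] is 1 there. *)
rewrite -sint_indic// (_ : weight f i = \1_(B i))//; apply/funext => x.
rewrite /weight {1}/f ltn_ord indicE; case: (boolP (x \in B i)) => [/set_mem Bx|]; last by rewrite mul0r.
rewrite mul1r.
have : (i <= N)%N by rewrite ltnW.
have : forall k, (k < i)%N -> f k x = 0.
  move=> k ki; rewrite /f (ltn_trans ki (ltn_ord i)) indicE memNset// => Bk.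
  have := tB k i I I (ex_intro _ x (conj Bk Bx)) => e; by rewrite e ltnn in ki.
elim: (nat_of_ord i) => [//|k ihk] h kN /=.
rewrite h// subr0 mulr1; apply: ihk; last by rewrite ltnW.
by move=> l lk; apply: h; rewrite ltnS ltnW.
Qed.

(** The directions [normalize (m (B i))] turn the pairings into norms; a null value gets the
    direction 0, which the condition [|z i| <= 1] admits. *)
Lemma sum_norm_le_Vvar (mu1 mu2 : X -> {finite_measure set XB -> \bar R}) N (m : set XB -> X)
    (B : nat -> set XB) (r : R) : V = r%:E -> represents mu1 mu2 ->
  (forall z A, measurable A -> ip (m A) z = fine (mu1 z A) - fine (mu2 z A)) ->
  (forall k, measurable (B k)) -> trivIset setT B ->
  \sum_(i < N) `|m (B i)| <= r.
Proof.
move=> Vr rep hm mB tB.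
have nz (w : X) : `|normalize w| <= 1.
  rewrite /normalize normrZ normfV normr_id; have [->|w0] := eqVneq w 0.
    by rewrite normr0 mulr0.
  by rewrite mulVf// normr_eq0.
have ipn (w : X) : ip w (normalize w) = `|w|.
  rewrite /normalize (ipZr ipP) (ipxx ipP); have [->|w0] := eqVneq w 0.
    by rewrite normr0 expr0n mulr0.
  by rewrite expr2 mulKf// normr_eq0.
apply: le_trans (sum_variation_le_Vvar N Vr rep (z := fun i => normalize (m (B i))) _ mB tB).
  by apply: ler_sum => i _; rewrite -hm// ipn.
by move=> i; exact: nz.
Qed.
End total_variation.

(** * The two inequalities and the construction of the vector measure *)

Section characterization.
Variables (R : realType) (X : completeNormedModType R) (ip : X -> X -> R).
Variables (nu : probability (hs_XB X) R) (Rop : {linear X -> X}).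
Variables (v : X -> X -> R) (p : R) (u : X -> R).
Hypothesis ipP : hs_is_inner_product ip.
Hypothesis sep : hs_separable_space X.
Hypothesis Rc : continuous Rop.
Hypothesis SA : hs_standing_assumption ip nu Rop v.
Hypothesis p1 : 1 < p.
Hypothesis uLp : hs_inLp nu p u.

Notation C1 := (C1 ip).
Notation wC1 := (wC1 ip).
Notation C1b := (hs_C1b ip).
Notation V := (hs_Vvar ip nu Rop v u).
Notation XB := (hs_XB X).
Notation dual := (dual ip nu Rop v u).
Notation represents := (represents ip nu Rop v u).
Notation BVm := (hs_BV_measure ip nu Rop v u).
Notation TV := hs_total_variation.

Lemma hs_total_variation_ge0 (m : set XB -> X) : (0 <= TV m)%E.
Proof.
pose B n : set XB := if n is 0%N then setT else set0.
apply: (@le_trans _ _ (\sum_(0 <= n <oo) (`|m (B n)|)%:E)%E); first by apply: nneseries_ge0.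
apply: ereal_sup_ubound; exists B; split.
  by case => [|n]; [exact: measurableT|exact: measurable0].
split; first by move=> [|i] [|j] _ _ //= [x []].
by split => //; apply/seteqP; split => // x _; exists 0%N.
Qed.

Lemma sum_norm_le_total_variation (m : set XB -> X) N (B : nat -> set XB) :
  (forall n, measurable (B n)) -> trivIset setT B -> \bigcup_n B n = setT ->
  ((\sum_(j < N) `|m (B j)|)%:E <= TV m)%E.
Proof.
move=> mB tB cB.
apply: (@le_trans _ _ (\sum_(0 <= n <oo) (`|m (B n)|)%:E)%E); last first.
  by apply: ereal_sup_ubound; exists B.
rewrite -sumEFin -(big_mkord xpredT (fun j => (`|m (B j)|)%:E)).
exact: nneseries_lim_ge.
Qed.

Lemma integral_dint z phi g : C1b phi g ->
  (\int[nu]_x ((u x * (ip (Rop (g x)) z - v z x * phi x))%:E) = (- dual z phi g)%:E)%E.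
Proof.
move=> h; have i1 := dint_integrable ipP Rc SA p1 uLp z h.
have i2 := integrableZl measurableT (-1) i1.
have E x : u x * (ip (Rop (g x)) z - v z x * phi x) = -1 * dint ip Rop v u z phi g x.
  by rewrite /dint; ring.
under eq_integral do rewrite E.
rewrite -[LHS]fineK; last exact: (integrable_fin_num measurableT i2).
congr EFin; have := RintegralZl (-1) measurableT i1; rewrite mulN1r; exact.
Qed.

Lemma sintE (mu1 mu2 : {finite_measure set XB -> \bar R}) phi : C1 phi ->
  (\int[mu1]_x ((phi x)%:E) - \int[mu2]_x ((phi x)%:E))%E = (sint mu1 mu2 phi)%:E.
Proof.
move=> h; have [M _ fM] := C1_bounded h; have mf := C1_measurable h.
have i1 := finite_bounded_integrable mu1 mf fM.
have i2 := finite_bounded_integrable mu2 mf fM.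
by rewrite /sint EFinB /Rintegral !fineK//; exact: integrable_fin_num.
Qed.

Lemma BV_measure_represents m : BVm m ->
  exists mu1 mu2 : X -> {finite_measure set XB -> \bar R}, represents mu1 mu2 /\
    forall z A, measurable A -> ip (m A) z = fine (mu1 z A) - fine (mu2 z A).
Proof.
move=> [_ [_ H]].
have fin (mu1 mu2 : {finite_measure set XB -> \bar R}) z :
    (forall B, measurable B -> (ip (m B) z)%:E = (mu1 B - mu2 B)%E) ->
    forall B, measurable B -> ip (m B) z = fine (mu1 B) - fine (mu2 B).
  move=> h B mB; apply: EFin_inj; rewrite h// EFinB !fineK//; exact: fin_num_measure.
have /choice[mm hmm] : forall z, exists mm :
      {finite_measure set XB -> \bar R} * {finite_measure set XB -> \bar R},
    forall B, measurable B -> ip (m B) z = fine (mm.1 B) - fine (mm.2 B).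
  (* The zero test function serves to extract one decomposition of [m_z] for each [z]; [sint_unique]
     compares the others with it. *)
  move=> z; have [I [[mu1 [mu2 [h _]]] _]] := H z _ _ (C1b_cst ipP 0).
  by exists (mu1, mu2); exact: fin h.
exists (fun z => (mm z).1), (fun z => (mm z).2); split; last exact: hmm.
move=> z phi g h; have [I [[mu1 [mu2 [h1 h2]]] h3]] := H z _ _ h.
have h1' := fin _ _ _ h1.
have c1 : C1 phi by exists g.
have [M _ fM] := C1_bounded c1.
have -> : sint (mm z).1 (mm z).2 phi = sint mu1 mu2 phi.
  have E B : measurable B -> fine ((mm z).1 B) - fine ((mm z).2 B) = fine (mu1 B) - fine (mu2 B).
    by move=> mB; rewrite -hmm// h1'.
  exact: (sint_unique E (C1_measurable c1) fM).
rewrite sintE// in h2; move: h3; rewrite (integral_dint _ h) h2 -EFinN.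
by case=> /oppr_inj.
Qed.

(** One finite partition quantises all [f i] at once. On each cell the field is replaced by its
    value at a sample point, a vector of norm at most 1, so the cell contributes at most
    [|m (B j)|]. *)
Lemma Vvar_le_total_variation m : BVm m -> (V <= TV m)%E.
Proof.
move=> hm; have [mu1 [mu2 [rep hmm]]] := BV_measure_represents hm.
have [_ [TVfin _]] := hm.
have TVf : TV m \is a fin_num by rewrite ge0_fin_numE// hs_total_variation_ge0.
pose t := fine (TV m).
apply: (Vvar_le ipP Rc SA p1 uLp) => n f g z hf f1.
rewrite -(fineK TVf) lee_fin -/t.
have cf i : C1 (f i) by exists (g i).
have mf i := C1_measurable (cf i).
have /choice[Mi hMi] : forall i, exists M, forall x, `|f i x| <= M.
  by move=> i; have [M _ h] := C1_bounded (cf i); exists M.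
have Mi0 i : 0 <= Mi i by apply: le_trans (hMi i 0).
pose M := \sum_(i < n) Mi i.
have fM i x : `|f i x| <= M.
  by apply: (le_trans (hMi i x)); rewrite /M (bigD1 i)//= lerDl sumr_ge0.
pose K := \sum_(i < n) (fine (mu1 (z i) setT) + fine (mu2 (z i) setT)).
have K0 : 0 <= K by apply: sumr_ge0 => i _; rewrite addr_ge0// fine_ge0.
have K1 : 0 < K + 1 by rewrite ltr_wpDl.
apply/ler_addgt0Pr => e e0.
pose d := e / (K + 1).
have d0 : 0 < d by rewrite divr_gt0.
pose F k : X -> R := if insub k is Some i then f i else fun=> 0.
have FE (i : 'I_n) : F i = f i by rewrite /F valK.
have mF k : measurable_fun [set: XB] (F k : XB -> R).
  by rewrite /F; case: insub => [i|]; [exact: mf|exact: measurable_cst].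
have FM k : (k < n)%N -> forall x, `|F k x| <= M.
  by move=> kn x; rewrite (FE (Ordinal kn)); exact: fM.
have [N [c [cN mc hc]]] := joint_level_code mF FM d0.
pose B j : set XB := [set x | c x = j].
(* For an empty cell the sample point is 0; the field has norm at most 1 there too. *)
pose rp j : X := xget 0 [set x | c x = j].
pose psi i j := f i (rp j).
have hpsi i x : `|f i x - psi i (c x)| <= d.
  rewrite /psi -FE; apply: hc => //.
  exact/esym/(@xgetPex _ 0 [set y | c y = c x] (ex_intro _ x erefl)).
have step i : sint (mu1 (z i)) (mu2 (z i)) (f i) <=
    \sum_(j < N) psi i j * ip (m (B j)) (z i) + d * (fine (mu1 (z i) setT) + fine (mu2 (z i) setT)).
  have := sint_step_approx (mu1 (z i)) (mu2 (z i)) (mf i) (fM i) cN mc (hpsi i).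
  move=> /(le_trans (ler_norm _)); rewrite lerBlDl => /le_trans; apply.
  by apply: lerD; first (apply: ler_sum => j _; rewrite hmm//; exact: mc).
apply: (@le_trans _ _ (\sum_(i < n) (\sum_(j < N) psi i j * ip (m (B j)) (z i) +
    d * (fine (mu1 (z i) setT) + fine (mu2 (z i) setT))))).
  by apply: ler_sum => i _; rewrite (rep _ _ _ (hf i)).
rewrite big_split /= lerD//; last first.
  by rewrite -mulr_sumr -/K /d mulrAC ler_pdivrMr// ler_wpM2l ?(ltW e0)// lerDl.
rewrite exchange_big /=.
apply: (@le_trans _ _ (\sum_(j < N) `|m (B j)|)).
  apply: ler_sum => j _.
  have -> : \sum_(i < n) psi i j * ip (m (B j)) (z i) = ip (\sum_(i < n) psi i j *: z i) (m (B j)).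
    by rewrite (ip_suml ipP); apply: eq_bigr => i _; rewrite (ipZl ipP) (ipC ipP (z i)).
  apply: (le_trans (ler_norm _)); apply: (le_trans (ip_CS ipP _ _)).
  by rewrite ler_piMl//; exact: f1.
rewrite -lee_fin /t fineK//; apply: sum_norm_le_total_variation => //.
  by move=> i j _ _ [x [<- <-]].
by apply/seteqP; split => // x _; exists (c x).
Qed.

Lemma total_variation_le_Vvar (mu1 mu2 : X -> {finite_measure set XB -> \bar R}) m :
  (V < +oo)%E -> represents mu1 mu2 ->
  (forall z A, measurable A -> ip (m A) z = fine (mu1 z A) - fine (mu2 z A)) ->
  (TV m <= V)%E.
Proof.
move=> Vfin rep hm.
have Vf : V \is a fin_num by rewrite ge0_fin_numE// (Vvar_ge0 ipP Rc SA p1 uLp).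
apply: ge_ereal_sup => _ [B [mB [tB [_ ->]]]].
apply: lime_le; first exact: is_cvg_nneseries.
apply: nearW => n; rewrite big_mkord sumEFin -(fineK Vf) lee_fin.
exact: (sum_norm_le_Vvar ipP sep Rc SA p1 uLp n (esym (fineK Vf)) rep hm mB tB).
Qed.

Lemma BV_of_Vvar_lty : (V < +oo)%E -> hs_inBV ip nu Rop v u.
Proof.
move=> Vfin.
have Vf : V \is a fin_num by rewrite ge0_fin_numE// (Vvar_ge0 ipP Rc SA p1 uLp).
pose r := fine V.
have Vr : V = r%:E by rewrite fineK.
have r0 : 0 <= r by rewrite fine_ge0// (Vvar_ge0 ipP Rc SA p1 uLp).
have /choice[mm rep0] : forall z, exists mm :
      {finite_measure set XB -> \bar R} * {finite_measure set XB -> \bar R},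
    forall phi g, C1b phi g -> dual z phi g = sint mm.1 mm.2 phi.
  move=> z; have [mu1 [mu2 h]] := dual_representation ipP sep Rc SA p1 uLp z Vfin.
  by exists (mu1, mu2).
pose mu1 z := (mm z).1; pose mu2 z := (mm z).2.
have rep : represents mu1 mu2 by exact: rep0.
pose mz z (A : set XB) : R := fine (mu1 z A) - fine (mu2 z A).
(* Linearity holds for integrals of [wC1] functions by [dual_linear_direction] and reaches [A]
   through the monotone class theorem. *)
have mz_lin (A : set XB) : measurable A -> forall a z w, mz (a *: z + w) A = a * mz z A + mz w A.
  move=> mA a z w.
  pose Q (h : X -> R) := [/\ measurable_fun [set: XB] (h : XB -> R), forall x, 0 <= h x <= 1 &
    sint (mu1 (a *: z + w)) (mu2 (a *: z + w)) h =
      a * sint (mu1 z) (mu2 z) h + sint (mu1 w) (mu2 w) h].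
  have Q0 h : wC1 h -> (forall x, 0 <= h x <= 1) -> Q h.
    move=> wh h01; have [[g hg] _] := wh; split => //; first exact: (C1_measurable (wC1_C1 wh)).
    rewrite -(rep _ _ _ hg) -(rep _ _ _ hg) -(rep _ _ _ hg).
    exact: (dual_linear_direction ipP sep Rc SA p1 uLp).
  have Ql : limit_closed Q.
    move=> F h FQ F01 Fh.
    have mF n : measurable_fun [set: XB] (F n : XB -> R) by have [] := FQ n.
    have mh : measurable_fun [set: XB] (h : XB -> R).
      by apply: (@measurable_fun_cvg _ XB R setT F h) => [n|x _]; [exact: mF|exact: Fh].
    have h01 x : 0 <= h x <= 1.
      apply/andP; split.
        by apply: (cvgr_to_ge (Fh x)); apply: nearW => n; have /andP[] := F01 n x.
      by apply: (cvgr_to_le (Fh x)); apply: nearW => n; have /andP[] := F01 n x.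
    split => //.
    have F1 n x : `|F n x| <= 1 by have /andP[b0 b1] := F01 n x; rewrite ger0_norm.
    have cv y := sint_dominated_cvg (mu1 := mu1 y) (mu2 := mu2 y) mF mh Fh F1.
    have c1 := cv (a *: z + w).
    have c2 : a * sint (mu1 z) (mu2 z) (F n) + sint (mu1 w) (mu2 w) (F n) @[n --> \oo]
        --> a * sint (mu1 z) (mu2 z) h + sint (mu1 w) (mu2 w) h.
      by apply: cvgD; [apply: cvgMr; exact: cv|exact: cv].
    rewrite (_ : (fun n => sint _ _ _) =
      (fun n => a * sint (mu1 z) (mu2 z) (F n) + sint (mu1 w) (mu2 w) (F n))) in c1.
      exact: (cvg_unique (@Rhausdorff R) c1 c2).
    by apply/funext => n; have [] := FQ n.
  by have [_ _] := monotone_class ipP sep Q0 Ql mA; rewrite !sint_indic.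
have mz_unit (A : set XB) z : measurable A -> `|z| <= 1 -> mz z A <= r.
  move=> mA z1; pose B n : set XB := if n is 0%N then A else set0.
  have mB n : measurable (B n) by case: n => [|n]; [exact: mA|exact: measurable0].
  have tB : trivIset setT B by move=> [|i] [|j] _ _ //= [x []].
  have := sum_variation_le_Vvar ipP sep Rc SA p1 uLp 1 (z := fun=> z) Vr rep (fun=> z1) mB tB.
  by rewrite big_ord1.
have mzZ (A : set XB) a z : measurable A -> mz (a *: z) A = a * mz z A.
  move=> mA; have h0 : mz 0 A = 0.
    by have := mz_lin A mA 1 0 0; rewrite scaler0 addr0 mul1r; lra.
  by have := mz_lin A mA a z 0; rewrite addr0 h0 addr0.
(* Dividing [z] by [1 + |z|] reduces to the unit ball, including [z = 0]. *)
have mz_bd (A : set XB) z : measurable A -> `|mz z A| <= r * (1 + `|z|).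
  move=> mA; have z1 : 0 < 1 + `|z| by rewrite ltr_pwDl.
  have unit (s : R) : `|s| = 1 -> s * mz z A <= r * (1 + `|z|).
    move=> s1; rewrite -ler_pdivrMr// mulrC mulrA -mzZ//; apply: mz_unit => //.
    rewrite normrZ normrM s1 mulr1 ger0_norm ?invr_ge0 ?(ltW z1)//.
    by rewrite mulrC ler_pdivrMr// mul1r lerDr.
  rewrite ler_norml; apply/andP; split.
    by have := unit (-1); rewrite normrN normr1 mulN1r => /(_ erefl); rewrite lerNl.
  by have := unit 1; rewrite normr1 mul1r; apply.
have /choice[m hm0] : forall A : set XB, exists w, measurable A -> forall z, mz z A = ip w z.
  move=> A; have [mA|nA] := pselect (measurable A); last by exists 0.
  have [w hw] := riesz_representation ipP (mz_lin A mA) (fun z => mz_bd A z mA).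
  by exists w.
have hm z A : measurable A -> ip (m A) z = fine (mu1 z A) - fine (mu2 z A).
  by move=> mA; rewrite -hm0.
exists m; split; last split.
- split.
    apply: (ip_inj ipP) => z; rewrite hm// !measure0 subrr (ip0l ipP)//.
  move=> B mB tB.
  (* The variation bound makes the series converge absolutely in [X]; its sum is then identified by
     pairing with each [z], where countable additivity of the scalar measures applies. *)
  have sN N : \sum_(i < N) `|m (B i)| <= r.
    exact: (sum_norm_le_Vvar ipP sep Rc SA p1 uLp N Vr rep hm mB tB).
  have cs : cvgn (series (fun n => m (B n))).
    apply: normed_cvg; apply: nondecreasing_is_cvgn.
      exact: (@nondecreasing_series _ (fun n => `|m (B n)|) xpredT 0%N (fun n _ _ => normr_ge0 _)).
    by exists r => _ [n _ <-]; have := sN n; rewrite -(big_mkord xpredT (fun i => `|m (B i)|)).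
  have mUB : measurable (\bigcup_n B n : set XB) by exact: bigcup_measurable.
  suff E : limn (series (fun n => m (B n))) = m (\bigcup_n B n) by rewrite -E; exact: cs.
  apply: (ip_inj ipP) => z; rewrite hm//.
  have c1 : ip (series (fun n => m (B n)) N) z @[N --> \oo] --> ip (limn (series (fun n => m (B n)))) z.
    by apply: ip_cvgl.
  have cmu (mu : {finite_measure set XB -> \bar R}) :
      \sum_(0 <= i < N) fine (mu (B i)) @[N --> \oo] --> fine (mu (\bigcup_n B n)).
    have h : (\sum_(0 <= i < n) mu (B i))%E @[n --> \oo] --> (fine (mu (\bigcup_n B n)))%:E.
      rewrite fineK; last exact: fin_num_measure.
      exact: (@measure_semi_sigma_additive _ _ _ mu B mB tB mUB).
    rewrite (_ : (fun N => \sum_(0 <= i < N) _) = fine \o (fun N => (\sum_(0 <= i < N) mu (B i))%E)).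
      exact: fine_cvg h.
    by apply/funext => N /=; apply: sum_fine => i _; exact: fin_num_measure.
  have c2 : ip (series (fun n => m (B n)) N) z @[N --> \oo] -->
      fine (mu1 z (\bigcup_n B n)) - fine (mu2 z (\bigcup_n B n)).
    rewrite (_ : (fun N => ip _ z) = (fun N => \sum_(0 <= i < N) fine (mu1 z (B i)) -
      \sum_(0 <= i < N) fine (mu2 z (B i)))); first exact: (cvgB (cmu (mu1 z)) (cmu (mu2 z))).
    apply/funext => N; rewrite /series /= (ip_suml ipP) -sumrB.
    by apply: eq_bigr => i _; rewrite hm.
  exact: (cvg_unique (@Rhausdorff R) c1 c2).
- exact: le_lt_trans (total_variation_le_Vvar Vfin rep hm) Vfin.
- move=> z phi g h; have c1 : C1 phi by exists g.
  exists (sint (mu1 z) (mu2 z) phi)%:E; split.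
    exists (mu1 z), (mu2 z); split; last by rewrite sintE.
    by move=> B mB; rewrite hm// EFinB !fineK//; exact: fin_num_measure.
  by rewrite (integral_dint _ h) (rep _ _ _ h) EFinN.
Qed.
End characterization.

Unset Implicit Arguments.
Set Strict Implicit.
Set Printing Implicit Defensive.

Theorem theorem3p5 (R : realType) (X : completeNormedModType R)
  (ip : X -> X -> R) (nu : probability (hs_XB X) R) (Rop : {linear X -> X})
  (v : X -> X -> R) (p : R) (u : X -> R) :
  hs_is_inner_product ip -> hs_separable_space X -> continuous Rop ->
  hs_standing_assumption ip nu Rop v ->
  1 < p -> hs_inLp nu p u ->
  (hs_inBV ip nu Rop v u <-> (hs_Vvar ip nu Rop v u < +oo)%E) /\
  (forall m, hs_BV_measure ip nu Rop v u m ->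
     hs_total_variation m = hs_Vvar ip nu Rop v u).
Proof.
move=> ipP sep Rc SA p1 uLp; split; first split.
- move=> [m hm]; have [_ [TVfin _]] := hm.
  exact: le_lt_trans (Vvar_le_total_variation ipP Rc SA p1 uLp hm) TVfin.
- exact: (BV_of_Vvar_lty ipP sep Rc SA p1 uLp).
- move=> m hm; have VT := Vvar_le_total_variation ipP Rc SA p1 uLp hm.
  have [mu1 [mu2 [rep hmm]]] := BV_measure_represents ipP Rc SA p1 uLp hm.
  have [_ [TVfin _]] := hm.
  apply/eqP; rewrite eq_le VT andbT.
  exact: (total_variation_le_Vvar ipP sep Rc SA p1 uLp (le_lt_trans VT TVfin) rep hmm).
Qed.
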